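(* Let $\boldsymbol S=(S_1,\dots,S_d)^\top$, $d\ge 2$, be a $d$-dimensional Lévy process with $\boldsymbol S(0)=0$, let $S=\sum_{i=1}^d S_i$ with Lévy exponent $\kappa$, and assume that $\kappa'(0)<0$, that $S$ is not the negative of a subordinator, and that $\kappa(\vartheta)=0$ has a real positive solution $\vartheta^*\in(0,\infty)$. Let $\mathbb Q$ be the exponentially tilted measure associated with $\vartheta^*$, and suppose $\mathbb E^{\mathbb Q}[|S_i(1)|]<\infty$ for all $i=1,\dots,d$. Then, for every $i\in\{1,\dots,d\}$, $$\lim_{u\to\infty} c_i(u,S,\infty)=\frac{m_i}{m},$$ where $$c_i(u,S,\infty)=\frac{\mathbb E[S_i(\tau(u))\mid \tau(u)<\infty]}{\mathbb E[S(\tau(u))\mid\tau(u)<\infty]},\qquad m=\sum_{i=1}^d m_i,\qquad m_i=\frac{\partial}{\partial\vartheta_i}\mathbb E\left[e^{\langle\boldsymbol\vartheta,\boldsymbol S(1)\rangle}\right]\Big|_{\boldsymbol\vartheta=\vartheta^*\boldsymbol 1}.$$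
   Context: All processes live on a probability space $(\Omega,\mathcal F,\mathbb P)$; $\mathbb E$ is expectation under $\mathbb P$. The Lévy exponent $\kappa$ of $S$ is given by $\mathbb E[e^{\vartheta S(t)}]=e^{t\kappa(\vartheta)}$ (wherever finite), so $\kappa'(0)=\mathbb E[S(1)]$. $\boldsymbol 1=(1,\dots,1)^\top\in\mathbb R^d$. The ruin time at level $u>0$ is $\tau(u)=\inf\{t\ge 0: S(t)\ge u\}$; it is assumed that $\mathbb P(\tau(u)<\infty)>0$. Exponential tilting: $\mathbb Q$ is the probability measure under which, with $\mathcal F_t=\sigma(\boldsymbol S(s),\,s\le t)$, the restrictions of $\mathbb Q$ and $\mathbb P$ to $\mathcal F_t$ are mutually absolutely continuous with likelihood ratio $\frac{d\mathbb Q}{d\mathbb P}\big|_{\mathcal F_t}=e^{\vartheta^* S(t)}$ for every $t\geq 0$ (recall $\kappa(\vartheta^* )=0$). Under $\mathbb Q$, $\boldsymbol S$ is again a Lévy process. The derivative defining $m_i$ is taken to satisfy $m_i=\mathbb E[S_i(1)e^{\vartheta^*S(1)}]=\mathbb E^{\mathbb Q}[S_i(1)]$, so that $m=\mathbb E^{\mathbb Q}[S(1)]=\kappa'(\vartheta^* )>0$. *)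

(* Defs.v *)
(* World: MathComp-Analysis. *)
From HB Require Import structures.
From mathcomp Require Import all_boot all_order all_algebra.
From mathcomp Require Import all_classical all_reals all_analysis.

Set Implicit Arguments.
Unset Strict Implicit.
Unset Printing Implicit Defensive.

Import Order.TTheory GRing.Theory Num.Theory.
Import numFieldNormedType.Exports.

Local Open Scope classical_set_scope.
Local Open Scope ring_scope.

(* A process with values in R^d is a map R -> T -> d.-tuple R; only its values
   at times t >= 0 matter.  The measurable structure of d.-tuple R is the
   product (that is, Borel) sigma-algebra. *)

Section levy_process.
Context {dp : measure_display} {T : measurableType dp} {R : realType}.

Definition cadlag (f : R -> R) : Prop :=
  (forall t, 0 <= t -> f x @[x --> t^'+] --> f t) /\
  (forall t, 0 < t -> cvg (f x @[x --> t^'-])).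

Definition increment (d : nat) (X : R -> T -> d.-tuple R) (s t : R) (w : T)
    : d.-tuple R :=
  [tuple tnth (X t w) i - tnth (X s w) i | i < d].

(* Mutual independence of finitely many increments; the product rule for
   subfamilies is obtained by taking B k = setT. *)
Definition independent_increments (P : probability T R) (d : nat)
    (X : R -> T -> d.-tuple R) : Prop :=
  forall (n : nat) (t : nat -> R) (B : nat -> set (d.-tuple R)),
    0 <= t 0%N -> {homo t : j k / (j <= k)%N >-> j <= k} ->
    (forall k, measurable (B k)) ->
    (P (\bigcap_(k in `I_n) (increment X (t k) (t k.+1) @^-1` B k)) =
     \prod_(k < n) P (increment X (t k) (t k.+1) @^-1` B k))%E.

Definition stationary_increments (P : probability T R) (d : nat)
    (X : R -> T -> d.-tuple R) : Prop :=
  forall (s t : R) (B : set (d.-tuple R)),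
    0 <= s -> 0 <= t -> measurable B ->
    P (increment X s (s + t) @^-1` B) = P (increment X 0 t @^-1` B).

(* Paths are cadlag for every outcome.  Stochastic continuity is not listed: it
   follows from right-continuity and stationarity of the increments. *)
Record levy_process (P : probability T R) (d : nat)
    (X : R -> T -> d.-tuple R) : Prop := {
  levy_measurable : forall t, 0 <= t -> measurable_fun setT (X t);
  levy_start0 : forall w i, tnth (X 0 w) i = 0;
  levy_independent : independent_increments P X;
  levy_stationary : stationary_increments P X;
  levy_cadlag : forall w i, cadlag (fun t => tnth (X t w) i) }.

Definition subordinator (P : probability T R) (Y : R -> T -> R) : Prop :=
  levy_process P (fun t w => [tuple Y t w]) /\
  {ae P, forall w, forall s t, 0 <= s -> s <= t -> Y s w <= Y t w}.

Definition component (d : nat) (X : R -> T -> d.-tuple R) (i : 'I_d)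
    (t : R) (w : T) : R := tnth (X t w) i.

Definition aggregate (d : nat) (X : R -> T -> d.-tuple R) (t : R) (w : T) : R :=
  \sum_(i < d) component X i t w.

Definition natural_filtration (d : nat) (X : R -> T -> d.-tuple R) (t : R)
    : set (set T) :=
  <<s \bigcup_(s in `[0, t]) preimage_set_system setT (X s) measurable >>.

(* kappa takes the value +oo exactly where the moment generating function is
   infinite. *)
Definition levy_exponent (P : probability T R) (Y : R -> T -> R)
    (kappa : R -> \bar R) : Prop :=
  forall theta t : R, 0 <= t ->
    'M_P (Y t) theta = expeR (t%:E * kappa theta)%E.

(* E[exp <theta, Z>] *)
Definition joint_mgf (P : probability T R) (d : nat) (Z : T -> d.-tuple R)
    (theta : 'I_d -> R) : \bar R :=
  'E_P[fun w => expR (\sum_(i < d) theta i * tnth (Z w) i)%R]%E.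

(* dQ/dP = exp (theta * (X_1 + ... + X_d)(t)) on F_t for every t >= 0.  The
   density being positive, Q and P are then mutually absolutely continuous on
   each F_t. *)
Definition exponentially_tilted (P Q : probability T R) (d : nat)
    (X : R -> T -> d.-tuple R) (theta : R) : Prop :=
  forall t : R, 0 <= t -> forall A : set T, natural_filtration X t A ->
    Q A = (\int[P]_(w in A) (expR (theta * aggregate X t w))%:E)%E.

Definition ruin_time (Y : R -> T -> R) (u : R) (w : T) : \bar R :=
  ereal_inf [set t%:E | t in [set t : R | 0 <= t /\ u <= Y t w]].

Definition ruin_event (Y : R -> T -> R) (u : R) : set T :=
  [set w | (ruin_time Y u w < +oo)%E].

(* E[Z | A] = E[Z 1_A] / P(A).  P(A) is written E[1_A], which is P A for
   measurable A; a ruin event is in general only almost surely equal to a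
   measurable set, where P A has no meaning but the integral still does. *)
Definition cond_expectation (P : probability T R) (A : set T) (Z : T -> R)
    : \bar R :=
  ('E_P[(fun w => Z w * \1_A w)%R] / 'E_P[\1_A])%E.

(* c_i(u, S, infty).  The junk value fine +oo is only used off the ruin event. *)
Definition contribution (P : probability T R) (d : nat)
    (X : R -> T -> d.-tuple R) (i : 'I_d) (u : R) : \bar R :=
  let tau := ruin_time (aggregate X) u in
  let A := ruin_event (aggregate X) u in
  (cond_expectation P A (fun w => component X i (fine (tau w)) w) /
   cond_expectation P A (fun w => aggregate X (fine (tau w)) w))%E.

End levy_process.

(* l is the derivative of f at x along the effective domain {f finite}: the
   usual derivative when x is interior to that domain, the one-sided one when
   x is an end point of it (l may then be infinite).  Exponents and moment
   generating functions may be infinite on one side of x. *)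
Definition domain_derivative {R : realType} (f : R -> \bar R) (x : R)
    (l : \bar R) : Prop :=
  f x \is a fin_num /\
  ((fine (f (x + h)) - fine (f x)) / h)%:E
    @[h --> within [set h | f (x + h) \is a fin_num] 0^'] --> l.

(* Main.v *)
(* Write S for the aggregate process, th for theta_star, e_t = exp (th S_t), a
   mean-one martingale under P, and Z = S_i - c S with c = m_i / m, so that
   E[Z_1 e_1] = 0.  Everything follows from two estimates for the first passage
   time tau of S above u: c1 e^(-th u) <= P(tau < oo) for some c1 > 0, and, for
   every eps > 0, E[|Z_tau|; tau < oo] <= e^(-th (u - 1)) (C + eps u) with C
   independent of u.  Since S_tau >= u, the ratio of the means of S_i and S at tau
   differs from c by O(1 / u) + O(eps).

   Under the tilted law Z is a mean-zero random walk on every dyadic grid, and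
   sqrt (L^2 + z^2) + K (v - s)^+, with L large, is superharmonic for unit steps
   below the level v because S drifts upwards at rate m; optional stopping gives
   the upper estimate on grids, uniformly in the mesh.  The lower one follows
   from a bound on the overshoot of S at integer times.

   To pass to continuous time, approximate tau by passages of grids of vanishing
   mesh above levels increasing to u.  The paths may jump at the limit of these
   passages, but the mean size of the increment just after a passage is that of
   an increment at time 0, which tends to 0; so almost surely there is no such
   jump and Fatou's lemma carries the grid estimates over to tau. *)

Require Import Defs.
From HB Require Import structures.
From mathcomp Require Import all_boot all_order all_algebra.
From mathcomp Require Import all_classical all_reals all_analysis.
From mathcomp Require Import measurable_realfun.
From mathcomp Require Import ring lra.

Import Order.TTheory GRing.Theory Num.Theory.
Import numFieldNormedType.Exports.
Import HBNNSimple.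

Local Open Scope classical_set_scope.
Local Open Scope ring_scope.

Set Implicit Arguments.
Unset Strict Implicit.
Unset Printing Implicit Defensive.

(** * Integrals of nonmeasurable functions *)

Section lower_integral.
Context {dp : measure_display} {T : measurableType dp} {R : realType}.
Variable mu : {measure set T -> \bar R}.
Local Open Scope ereal_scope.

(* The integral of a nonnegative function is the supremum of the integrals of
   its simple minorants, whether or not the function is measurable: these
   lemmas do not assume [f] measurable, because hitting times are not. *)
Lemma integral_le_minorants (f : T -> \bar R) (b : \bar R) :
  (forall x, 0 <= f x) ->
  (forall h : {nnsfun T >-> R}, (forall x, (h x)%:E <= f x) ->
     \int[mu]_x (h x)%:E <= b) ->
  \int[mu]_x f x <= b.
Proof.
move=> f0 H; rewrite ge0_integralTE//.
apply: ge_ereal_sup => _ [h hf <-]; rewrite -integralT_nnsfun; exact: H.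
Qed.

Lemma ge0_le_integral_lower (D : set T) (f g : T -> \bar R) :
  (forall x, D x -> 0 <= f x) -> (forall x, D x -> f x <= g x) ->
  \int[mu]_(x in D) f x <= \int[mu]_(x in D) g x.
Proof.
move=> f0 fg; rewrite integral_mkcond [leRHS]integral_mkcond.
have {}f0 x : 0 <= (f \_ D) x by apply: erestrict_ge0.
have {}fg x : (f \_ D) x <= (g \_ D) x.
  by rewrite /patch; case: ifPn => // /set_mem/fg.
rewrite !ge0_integralTE//; last by move=> x; exact: le_trans (fg x).
apply: ereal_sup_le => _ [h hf <-]; exists h => // x.
exact: le_trans (hf x) (fg x).
Qed.

Lemma ge0_integralD_lower_le (f g : T -> \bar R) :
  (forall x, 0 <= f x) -> (forall x, 0 <= g x) -> measurable_fun setT g ->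
  \int[mu]_x (f x + g x) <= \int[mu]_x f x + \int[mu]_x g x.
Proof.
move=> f0 g0 mg; apply: integral_le_minorants => [x|h hfg]; first exact: adde_ge0.
pose k x := maxe ((h x)%:E - g x) 0.
have mk : measurable_fun setT k.
  apply: measurable_maxe => //; apply: emeasurable_funB => //.
  exact/measurable_EFinP.
have k0 x : 0 <= k x by rewrite /k le_max lexx orbT.
have kf x : k x <= f x.
  rewrite /k ge_max f0 andbT.
  move: (hfg x) (f0 x) (g0 x); case: (f x) => [a||]; case: (g x) => [c||] //=;
    rewrite ?leey ?leNye//.
  by rewrite -EFinD -EFinB !lee_fin => A _ _; lra.
apply: (@le_trans _ _ (\int[mu]_x (k x + g x))).
  apply: ge0_le_integral => //.
  - by move=> x _; rewrite lee_fin fun_ge0.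
  - exact/measurable_EFinP.
  - by apply: emeasurable_funD.
  - move=> x _; move: (k0 x); rewrite /k; move: (g0 x).
    case: (g x) => [c||] //= c0 kge.
      by rewrite -EFinB -EFin_max -EFinD lee_fin -lerBlDr le_max lexx.
    by rewrite addey ?leey// gt_eqF// (lt_le_trans _ kge).
rewrite ge0_integralD//; apply: leeD => //; exact: ge0_le_integral_lower.
Qed.

Lemma ge0_integralZl_lower_le (f : T -> \bar R) (c : R) :
  (forall x, 0 <= f x) -> (0 <= c)%R ->
  \int[mu]_x (c%:E * f x) <= c%:E * \int[mu]_x f x.
Proof.
move=> f0 c_ge0; have [->|cn0] := eqVneq c 0%R.
  by under eq_integral do rewrite mul0e; rewrite integral0 mul0e.
have c0 : (0 < c)%R by rewrite lt_neqAle eq_sym cn0.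
apply: integral_le_minorants => [x|h hf].
  by rewrite mule_ge0// lee_fin ltW.
rewrite muleC -lee_pdivrMr// muleC -ge0_integralZl_EFin//; last 3 first.
  by move=> x _; rewrite lee_fin fun_ge0.
  exact/measurable_EFinP.
  by rewrite invr_ge0 ltW.
apply: ge0_le_integral_lower => x _.
  by rewrite mule_ge0 ?lee_fin ?invr_ge0 ?(ltW c0)// fun_ge0.
by rewrite muleC lee_pdivrMr// muleC.
Qed.

Lemma ge0_integralZl_lower (f : T -> \bar R) (c : R) :
  (forall x, 0 <= f x) -> (0 <= c)%R ->
  \int[mu]_x (c%:E * f x) = c%:E * \int[mu]_x f x.
Proof.
move=> f0 c_ge0; apply/eqP; rewrite eq_le ge0_integralZl_lower_le//=.
have [->|cn0] := eqVneq c 0%R.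
  by rewrite mul0e integral_ge0// => x _; rewrite mul0e.
have {cn0}c0 : (0 < c)%R by rewrite lt_neqAle eq_sym cn0.
rewrite muleC -lee_pdivlMr// muleC.
apply: le_trans (@ge0_integralZl_lower_le (fun x => c%:E * f x) c^-1 _ _);
  rewrite ?invr_ge0 ?(ltW c0)//; last by move=> x; rewrite mule_ge0// lee_fin ltW.
apply: ge0_le_integral_lower => // x.
by rewrite muleA -EFinM mulVf ?gt_eqF// mul1e.
Qed.

(* Only [G] is measurable: each of [f^\+] and [f^\-] is within [\int G] of the
   corresponding part of [c * D]. *)
Lemma integral_perturb_lower (f D : T -> R) (G : T -> \bar R) (c g : R) :
  (forall x, 0 <= D x)%R -> measurable_fun setT G ->
  (forall x, (`|f x - c * D x|)%:E <= G x) ->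
  \int[mu]_x (D x)%:E < +oo -> \int[mu]_x G x <= g%:E ->
  \int[mu]_x (f x)%:E \is a fin_num /\
  (`|fine (\int[mu]_x (f x)%:E) - c * fine (\int[mu]_x (D x)%:E)| <= g *+ 2)%R.
Proof.
move=> D0 mG fDG Doo Gg.
have G0 x : 0 <= G x by exact: le_trans (fDG x).
set I := \int[mu]_x (D x)%:E in Doo *.
have I0 : 0 <= I by apply: integral_ge0 => x _; rewrite lee_fin.
have Ifin : I \is a fin_num by rewrite ge0_fin_numE.
have key (s p : R) : (s = 1 \/ s = -1)%R -> p = Num.max (s * c)%R 0%R ->
    let a := \int[mu]_x (Num.max (s * f x) 0)%:E in
    a \is a fin_num /\ (`|fine a - p * fine I| <= g)%R.
  move=> s1 pE a.
  have p0 : (0 <= p)%R by rewrite pE le_max lexx orbT.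
  have pD x : Num.max (s * (c * D x))%R 0%R = (p * D x)%R.
    by rewrite mulrA pE maxr_pMl// mul0r.
  have fcD x : (`|Num.max (s * f x) 0 - p * D x| <= `|f x - c * D x|)%R.
    rewrite -pD; apply: le_trans (_ : (`|s * f x - s * (c * D x)| <= _)%R).
      set a' := (s * f x)%R; set b' := (s * _)%R.
      rewrite ler_norml /Num.max.
      by case: (ltP a' 0%R) => ?; case: (ltP b' 0%R) => ?; case: (ler0P (a' - b'));
        move=> *; apply/andP; split; lra.
    by rewrite -mulrBr normrM; case: s1 => ->; rewrite ?normrN normr1 mul1r.
  have a0 : 0 <= a by apply: integral_ge0 => x _; rewrite lee_fin le_max lexx orbT.
  have pI : \int[mu]_x (p * D x)%:E = p%:E * I.
    rewrite -ge0_integralZl_lower// => x; by rewrite lee_fin.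
  have le1 : a <= p%:E * I + g%:E.
    apply: le_trans (leeD (lexx _) Gg); rewrite -pI.
    apply: le_trans (ge0_integralD_lower_le _ _ mG) => //; last first.
      by move=> x; rewrite lee_fin mulr_ge0.
    apply: ge0_le_integral_lower => x _; first by rewrite lee_fin le_max lexx orbT.
    apply: le_trans (leeD (lexx _) (fDG x)); rewrite -EFinD lee_fin.
    have := fcD x; rewrite ler_norml => /andP[]; lra.
  have le2 : p%:E * I <= a + g%:E.
    apply: le_trans (leeD (lexx _) Gg); rewrite -pI.
    apply: le_trans (ge0_integralD_lower_le _ _ mG) => //; last first.
      by move=> x; rewrite lee_fin le_max lexx orbT.
    apply: ge0_le_integral_lower => x _; first by rewrite lee_fin mulr_ge0.
    apply: le_trans (leeD (lexx _) (fDG x)); rewrite -EFinD lee_fin.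
    have := fcD x; rewrite ler_norml => /andP[]; lra.
  have afin : a \is a fin_num.
    rewrite ge0_fin_numE// (le_lt_trans le1)// -(fineK Ifin) -EFinM -EFinD ltry//.
  split => //; move: le1 le2; rewrite -(fineK Ifin) -(fineK afin) -!EFinM -!EFinD !lee_fin /=.
  by rewrite ler_norml => ? ?; apply/andP; split; lra.
have [af1 H1] := key 1%R _ (or_introl erefl) erefl.
have [af2 H2] := key (-1)%R _ (or_intror erefl) erefl.
have fE : \int[mu]_x (f x)%:E =
    \int[mu]_x (Num.max (1 * f x) 0)%:E - \int[mu]_x (Num.max (-1 * f x) 0)%:E.
  rewrite integralE; congr (_ - _); apply: eq_integral => x _.
    by rewrite funeposE mul1r EFin_max.
  by rewrite funenegE mulN1r EFin_max.
rewrite fE fin_numB af1 af2; split => //.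
rewrite fineB// mulr2n.
have -> : (c = Num.max (1 * c) 0 - Num.max (-1 * c) 0)%R.
  by rewrite mul1r mulN1r /Num.max; case: ifPn; case: ifPn; rewrite -?leNgt => *; lra.
rewrite mulrBl.
apply: le_trans (lerD H1 H2).
set a := fine _; set b := fine (integral _ _ _); set p := (_ * fine I)%R; set q := (_ * fine I)%R.
have -> : (a - b - (p - q) = (a - p) - (b - q))%R by ring.
exact: ler_normB.
Qed.

End lower_integral.

Section independence.
Context {dp : measure_display} {T : measurableType dp} {R : realType}.
Variable P : probability T R.
Local Open Scope ereal_scope.

Section pair.
Context {d1 d2 : measure_display} {T1 : measurableType d1} {T2 : measurableType d2}.
Variables (V1 : T -> T1) (V2 : T -> T2).
Hypotheses (mV1 : measurable_fun setT V1) (mV2 : measurable_fun setT V2).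
Hypothesis V12 : forall A B, measurable A -> measurable B ->
  P (V1 @^-1` A `&` V2 @^-1` B) = P (V1 @^-1` A) * P (V2 @^-1` B).
Variable f : T1 * T2 -> \bar R.
Hypotheses (f0 : forall x, 0 <= f x) (mf : measurable_fun setT f).

Let X1 : {RV P >-> T1} := HB.pack V1 (isMeasurableFun.Build _ _ _ _ _ mV1).
Let X2 : {RV P >-> T2} := HB.pack V2 (isMeasurableFun.Build _ _ _ _ _ mV2).
Let mX : measurable_fun setT (fun w => (V1 w, V2 w)).
Proof. exact/measurable_fun_pair. Qed.
Let X : {RV P >-> (T1 * T2)%type} :=
  HB.pack (fun w => (V1 w, V2 w)) (isMeasurableFun.Build _ _ _ _ _ mX).

Let distr_prod A : measurable A ->
  (distribution P X1 \x distribution P X2) A = distribution P X A.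
Proof.
by apply: product_measure_unique => B C mB mC; rewrite -V12.
Qed.

Let joint : \int[P]_w f (V1 w, V2 w) =
  \int[distribution P X1 \x distribution P X2]_z f z.
Proof.
rewrite (eq_measure_integral (distribution P X)) => [|A mA _]; last exact: distr_prod.
by rewrite ge0_integral_distribution.
Qed.

Lemma integral_indep :
  \int[P]_w f (V1 w, V2 w) = \int[P]_w \int[P]_w' f (V1 w, V2 w').
Proof.
rewrite joint fubini_tonelli1// ge0_integral_distribution//.
- apply: eq_integral => w _ /=.
  rewrite /fubini_F ge0_integral_distribution//.
  by apply: measurableT_comp => //; exact: measurable_pair1.
- exact: measurable_fun_fubini_tonelli_F.
- by move=> x; apply: integral_ge0.
Qed.

End pair.

(* Both sides are finite measures in [A], hence agree once they agree on the
   pi-system [G]. *)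
Lemma indep_g_sigma_algebra (G : set (set T)) (E : set T) :
  G `<=` measurable -> G setT -> setI_closed G -> measurable E ->
  (forall A, G A -> P (A `&` E) = P A * P E) ->
  forall A, <<s G >> A -> P (A `&` E) = P A * P E.
Proof.
move=> Gm GT GI mE GE A sA.
have PE0 : (0 <= fine (P E))%R by exact: fine_ge0.
pose m2 := mscale (NngNum PE0) P.
have m2E B : m2 B = P B * P E.
  by rewrite /m2 /mscale /= muleC fineK// fin_num_measure.
rewrite -m2E; apply: (g_sigma_algebra_measure_unique G Gm (fun=> setT) _ _
  (mrestr P mE) m2) => //.
- by rewrite bigcup_const//; exists 0%N.
- by move=> B GB; exact: etrans (GE _ GB) (esym (m2E B)).
- by move=> _; rewrite /= /mrestr setTI ltey_eq fin_num_measure.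
Qed.

End independence.

(** * Planar Levy processes *)

Section planar_levy.
Context {dp : measure_display} {T : measurableType dp} {R : realType}.
Implicit Types S Z : R -> T -> R.

Definition planar S Z (t : R) (w : T) : R * R := (S t w, Z t w).

Definition planar_step S Z (s t : R) (w : T) : R * R :=
  (S t w - S s w, Z t w - Z s w).

Record planar_levy (P : probability T R) S Z : Prop := {
  planar_measurable1 : forall t, 0 <= t -> measurable_fun setT (S t);
  planar_measurable2 : forall t, 0 <= t -> measurable_fun setT (Z t);
  planar_start1 : forall w, S 0 w = 0;
  planar_start2 : forall w, Z 0 w = 0;
  planar_independent : forall (n : nat) (t : nat -> R) (B : nat -> set (R * R)),
    0 <= t 0%N -> {homo t : j k / (j <= k)%N >-> j <= k} ->
    (forall k, measurable (B k)) ->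
    (P (\bigcap_(k in `I_n) (planar_step S Z (t k) (t k.+1) @^-1` B k)) =
     \prod_(k < n) P (planar_step S Z (t k) (t k.+1) @^-1` B k))%E;
  planar_stationary : forall (s t : R) (B : set (R * R)),
    0 <= s -> 0 <= t -> measurable B ->
    P (planar_step S Z s (s + t) @^-1` B) = P (planar_step S Z 0 t @^-1` B);
  planar_cadlag1 : forall w, cadlag (S ^~ w);
  planar_cadlag2 : forall w, cadlag (Z ^~ w) }.

Definition grid_boxes S Z (h : R) (k : nat) : set (set T) :=
  [set A | exists2 B : nat -> set (R * R), (forall i, measurable (B i)) &
    A = \bigcap_(i in `I_k)
          (planar_step S Z (i%:R * h) (i.+1%:R * h) @^-1` B i)].

Definition grid_past S Z (h : R) (k : nat) : set (set T) :=
  <<s grid_boxes S Z h k >>.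

Variables (P : probability T R) (S Z : R -> T -> R).
Hypothesis L : planar_levy P S Z.

Lemma measurable_planar t : 0 <= t -> measurable_fun setT (planar S Z t).
Proof.
move=> t0; apply/measurable_fun_pair.
  exact: planar_measurable1 L _ t0.
exact: planar_measurable2 L _ t0.
Qed.

Lemma measurable_planar_step s t : 0 <= s -> 0 <= t ->
  measurable_fun setT (planar_step S Z s t).
Proof.
move=> s0 t0; apply/measurable_fun_pair; apply: measurable_funB.
- exact: planar_measurable1 L _ t0.
- exact: planar_measurable1 L _ s0.
- exact: planar_measurable2 L _ t0.
- exact: planar_measurable2 L _ s0.
Qed.

Lemma planar_step0 t : planar_step S Z 0 t = planar S Z t.
Proof.
apply/funext => w.
by rewrite /planar_step /planar (planar_start1 L) (planar_start2 L) !subr0.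
Qed.

Variable h : R.
Hypothesis h0 : 0 <= h.

Let grid0 i : 0 <= i%:R * h. Proof. exact: mulr_ge0. Qed.

Lemma grid_boxes_measurable k : grid_boxes S Z h k `<=` measurable.
Proof.
move=> _ [B mB ->]; apply: bigcap_measurableType => i _.
rewrite -[X in measurable X]setTI.
by apply: (measurable_planar_step (grid0 i) (grid0 i.+1)).
Qed.

Lemma grid_past_measurable k : grid_past S Z h k `<=` measurable.
Proof. exact: smallest_sub (@sigma_algebra_measurable _ T) (@grid_boxes_measurable k). Qed.

Lemma grid_boxesT k : grid_boxes S Z h k setT.
Proof.
by exists (fun=> setT) => //; apply/esym; rewrite -subTset => w _ i _.
Qed.

Lemma grid_boxesI k : setI_closed (grid_boxes S Z h k).
Proof.
move=> _ _ [B mB ->] [C mC ->]; exists (fun i => B i `&` C i).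
  by move=> i; exact: measurableI.
by rewrite -bigcapI; apply: eq_bigcapr => i _; rewrite preimage_setI.
Qed.

Lemma sub_grid_past k l : (k <= l)%N -> grid_past S Z h k `<=` grid_past S Z h l.
Proof.
move=> kl; apply: smallest_sub; first exact: smallest_sigma_algebra.
move=> _ [B mB ->]; apply: sub_sigma_algebra.
exists (fun i => if (i < k)%N then B i else setT); first by move=> i; case: ifP.
apply/seteqP; split => w Hw i /= ilt.
  by case: ifP => // ik; exact: Hw.
by have := Hw i (leq_trans ilt kl); rewrite ilt.
Qed.

Lemma grid_past_indep k dl A C : 0 <= dl -> grid_past S Z h k A -> measurable C ->
  (P (A `&` planar_step S Z (k%:R * h) (k%:R * h + dl) @^-1` C) =
   P A * P (planar_step S Z (k%:R * h) (k%:R * h + dl) @^-1` C))%E.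
Proof.
move=> dl0 pA mC; move: A pA.
apply: (indep_g_sigma_algebra (@grid_boxes_measurable k) (grid_boxesT k) (@grid_boxesI k)).
  rewrite -[X in measurable X]setTI.
  by apply: measurable_planar_step => //; rewrite addr_ge0.
move=> _ [B mB ->].
pose t i := if (i <= k)%N then i%:R * h else k%:R * h + dl.
have th : {homo t : j k / (j <= k)%N >-> j <= k}.
  move=> i j ij; rewrite /t; case: leqP => ik; case: leqP => jk.
  - by rewrite ler_wpM2r// ler_nat.
  - by rewrite (@le_trans _ _ (k%:R * h)) ?lerDl// ler_wpM2r// ler_nat.
  - by have := leq_ltn_trans (leq_trans ij jk) ik; rewrite ltnn.
  - exact: lexx.
have t0 : 0 <= t 0%N by rewrite /t leq0n mul0r.
pose D i := if (i < k)%N then B i else C.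
have mD i : measurable (D i) by rewrite /D; case: ifP.
have tE i : (i < k)%N -> planar_step S Z (t i) (t i.+1) @^-1` D i =
    planar_step S Z (i%:R * h) (i.+1%:R * h) @^-1` B i.
  by move=> ik; rewrite /t /D ik (ltnW ik).
have tk : planar_step S Z (t k) (t k.+1) @^-1` D k =
    planar_step S Z (k%:R * h) (k%:R * h + dl) @^-1` C.
  by rewrite /t /D ltnn leqnn.
have boxE : \bigcap_(i in `I_k) (planar_step S Z (i%:R * h) (i.+1%:R * h) @^-1` B i) =
    \bigcap_(i in `I_k) (planar_step S Z (t i) (t i.+1) @^-1` D i).
  by apply: eq_bigcapr => i /= ik; rewrite tE.
rewrite boxE -tk (planar_independent L)//.
have := planar_independent L k.+1 t0 th mD; rewrite big_ord_recr /= => <-.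
congr (P _); apply/seteqP; split => w.
  move=> [Hw Hk] i /=; rewrite ltnS leq_eqVlt => /predU1P[-> //|]; exact: Hw.
by move=> Hw; split => [i ik|]; apply: Hw => //=; exact: ltnW.
Qed.

End planar_levy.

Section grid_walk.
Context {dp : measure_display} {T : measurableType dp} {R : realType}.
Variables (P : probability T R) (S Z : R -> T -> R).
Hypothesis L : planar_levy P S Z.

Lemma measurable_grid_past (h : R) (l k : nat) : (l <= k)%N ->
  measurable_fun [set: g_sigma_algebraType (grid_boxes S Z h k)]
    (planar S Z (l%:R * h)).
Proof.
move=> lk; pose Tk := g_sigma_algebraType (grid_boxes S Z h k).
have mstep i : (i < k)%N ->
    measurable_fun [set: Tk] (planar_step S Z (i%:R * h) (i.+1%:R * h)).
  move=> ik _ B mB; rewrite setTI; apply: sub_sigma_algebra.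
  exists (fun j => if j == i then B else setT); first by move=> j; case: ifP.
  apply/seteqP; split => w Hw; last by have := Hw i ik; rewrite eqxx.
  by move=> j jk; case: eqP => // ->.
have SE : S (l%:R * h) = fun w =>
    \sum_(i < l) (planar_step S Z (i%:R * h) (i.+1%:R * h) w).1.
  apply/funext => w; rewrite -(big_mkord xpredT (fun i =>
    (planar_step S Z (i%:R * h) (i.+1%:R * h) w).1)).
  by rewrite telescope_sumr// mul0r (planar_start1 L) subr0.
have ZE : Z (l%:R * h) = fun w =>
    \sum_(i < l) (planar_step S Z (i%:R * h) (i.+1%:R * h) w).2.
  apply/funext => w; rewrite -(big_mkord xpredT (fun i =>
    (planar_step S Z (i%:R * h) (i.+1%:R * h) w).2)).
  by rewrite telescope_sumr// mul0r (planar_start2 L) subr0.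
apply/measurable_fun_pair; rewrite /= ?SE ?ZE; apply: measurable_sum => i;
  have := mstep i (leq_trans (ltn_ord i) lk).
- by move=> m; apply: (measurableT_comp measurable_fst m).
- by move=> m; apply: (measurableT_comp measurable_snd m).
Qed.

Lemma markov_step (h dl : R) (k : nat) (A : set T) (f : (R * R) * (R * R) -> \bar R) :
  0 <= h -> 0 <= dl -> grid_past S Z h k A ->
  (forall x, (0 <= f x)%E) -> measurable_fun setT f ->
  (\int[P]_(w in A) f (planar S Z (k%:R * h) w,
                       planar_step S Z (k%:R * h) (k%:R * h + dl) w) =
   \int[P]_(w in A) \int[P]_w' f (planar S Z (k%:R * h) w, planar S Z dl w'))%E.
Proof.
move=> h0 dl0 pA f0 mf.
pose Tk := g_sigma_algebraType (grid_boxes S Z h k).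
pose g (x : Tk * (R * R)) : \bar R :=
  (f (planar S Z (k%:R * h) x.1, x.2) * (\1_A x.1)%:E)%E.
have g0 x : (0 <= g x)%E by rewrite mule_ge0// lee_fin.
have mg : measurable_fun setT g.
  apply: emeasurable_funM.
    apply: (measurableT_comp mf); apply/measurable_fun_pair => //=.
    apply: (@measurableT_comp _ _ _ _ _ _ (planar S Z (k%:R * h) : Tk -> _)) => //.
    exact: measurable_grid_past.
  apply/measurable_EFinP.
  apply: (@measurableT_comp _ _ _ _ _ _ (\1_A : Tk -> R)) => //.
have kh0 : 0 <= k%:R * h by rewrite mulr_ge0.
have mid : measurable_fun setT (idfun : T -> Tk).
  by move=> _ B mB; rewrite setTI; apply: (grid_past_measurable L h0); exact: mB.
have mstep : measurable_fun setT (planar_step S Z (k%:R * h) (k%:R * h + dl)).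
  by apply: (measurable_planar_step L) => //; rewrite addr_ge0.
have mdl := measurable_planar L dl0.
rewrite integral_mkcond [RHS]integral_mkcond.
transitivity (\int[P]_w g (w, planar_step S Z (k%:R * h) (k%:R * h + dl) w))%E.
  by apply: eq_integral => w _; rewrite epatch_indic.
rewrite (integral_indep mid mstep) => // [|B C mB mC]; last first.
  exact: (grid_past_indep L h0).
apply: eq_integral => w _; rewrite /g /= epatch_indic /=.
have -> : (\int[P]_w' (f (planar S Z (k%:R * h) w,
      planar_step S Z (k%:R * h) (k%:R * h + dl) w') * (\1_A w)%:E) =
    \int[P]_w' (f (planar S Z (k%:R * h) w, planar S Z dl w') * (\1_A w)%:E))%E.
  pose G y : \bar R := (f (planar S Z (k%:R * h) w, y) * (\1_A w)%:E)%E.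
  have G0 y : (0 <= G y)%E by rewrite mule_ge0// lee_fin.
  have mG : measurable_fun setT G.
    apply: emeasurable_funM => //.
    by apply: (measurableT_comp mf); exact: measurable_pair1.
  have pushG V : measurable_fun setT V ->
      (\int[P]_w' G (V w') = \int[pushforward P V]_y G y)%E.
    by move=> mV; rewrite ge0_integral_pushforward// preimage_setT.
  rewrite (pushG _ mstep) (pushG _ mdl).
  apply: eq_measure_integral => B mB _; rewrite /= /pushforward.
  by rewrite (planar_stationary L)// (planar_step0 L).
rewrite ge0_integralZr//.
by apply: (measurableT_comp mf); apply/measurable_fun_pair.
Qed.

End grid_walk.

Section tilted_walk.
Context {dp : measure_display} {T : measurableType dp} {R : realType}.
Variables (P : probability T R) (S Z : R -> T -> R) (th : R).

(* Expectation, under the tilted law on the paths up to time [t], of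
   [g (S t, Z t)] on the event [A]. *)
Definition tilted_mean (t : R) (A : set T) (g : R * R -> \bar R) : \bar R :=
  (\int[P]_(w in A) (g (planar S Z t w) * (expR (th * S t w))%:E))%E.

Definition tilted_shift (t : R) (g : R * R -> \bar R) (x : R * R) : \bar R :=
  tilted_mean t setT (fun y => g (x.1 + y.1, x.2 + y.2)).

Definition stays (h v : R) (k : nat) : set T :=
  [set w | forall l, (l < k)%N -> S (l%:R * h) w <= v].

Definition crosses (h v : R) (k : nat) : set T :=
  stays h v k `&` [set w | v < S (k%:R * h) w].

Lemma stays0 h v : stays h v 0 = setT.
Proof. by rewrite -subTset => w _ l. Qed.

Lemma staysS_crosses h v k : stays h v k = stays h v k.+1 `|` crosses h v k.
Proof.
apply/seteqP; split => [w Hw|w [Hw|[]//]]; last first.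
  by move=> l lk; apply: Hw; exact: ltnW.
have [Sv|Sv] := leP (S (k%:R * h) w) v; [left|by right].
by move=> l; rewrite ltnS leq_eqVlt => /predU1P[->//|]; exact: Hw.
Qed.

Lemma staysS_crosses_disj h v k : [disjoint stays h v k.+1 & crosses h v k].
Proof.
apply/disj_setPS => w [Hw [_ /=]]; by rewrite ltNge (Hw k (ltnSn k)).
Qed.

Lemma sub_stays h v k l : (k <= l)%N -> stays h v l `<=` stays h v k.
Proof. by move=> kl w Hw i ik; apply: Hw; exact: leq_trans kl. Qed.

Hypothesis L : planar_levy P S Z.
Hypothesis th_mean : forall t, 0 <= t -> (\int[P]_w (expR (th * S t w))%:E = 1)%E.

Lemma grid_past_le h v k l : (l <= k)%N ->
  grid_past S Z h k [set w | S (l%:R * h) w <= v].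
Proof.
move=> lk; have m := measurable_grid_past L (h := h) lk.
have := m measurableT ([set x | x.1 <= v] : set (R * R)).
rewrite setTI; apply.
rewrite -[X in measurable X]setTI.
have -> : [set x : R * R | x.1 <= v] = fst @^-1` `]-oo, v]%classic.
  by apply/seteqP; split => x /=; rewrite in_itv.
exact: measurable_fst.
Qed.

Lemma grid_past_stays h v k : grid_past S Z h k (stays h v k.+1).
Proof.
pose Tk := g_sigma_algebraType (grid_boxes S Z h k).
have -> : stays h v k.+1 = \bigcap_(l in `I_k.+1) [set w | S (l%:R * h) w <= v].
  by apply/seteqP; split => w Hw.
by apply: (@bigcap_measurableType _ Tk) => l lk; exact: grid_past_le.
Qed.

Lemma grid_past_crosses h v k : grid_past S Z h k (crosses h v k).
Proof.
have -> : crosses h v k = stays h v k `&` ~` [set w | S (k%:R * h) w <= v].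
  by congr (_ `&` _); apply/seteqP; split => w /=; rewrite ltNge => /negP.
pose Tk := g_sigma_algebraType (grid_boxes S Z h k).
apply: (@measurableI _ Tk).
  case: k @Tk => [|k] Tk; first by rewrite stays0; exact: (@measurableT _ Tk).
  apply: (sub_grid_past (leqnSn k)); exact: grid_past_stays.
by apply: (@measurableC _ Tk); exact: grid_past_le.
Qed.

Lemma measurable_weight t : 0 <= t ->
  measurable_fun setT (fun w => (expR (th * S t w))%:E).
Proof.
move=> t0; apply/measurable_EFinP; apply: (measurableT_comp (@measurable_expR R)).
by apply: measurable_funM => //; exact: planar_measurable1 L _ t0.
Qed.

Lemma measurable_tilted t g : 0 <= t -> measurable_fun setT g ->
  measurable_fun setT (fun w => g (planar S Z t w) * (expR (th * S t w))%:E)%E.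
Proof.
move=> t0 mg; apply: emeasurable_funM; last exact: measurable_weight.
exact: (measurableT_comp mg (measurable_planar L t0)).
Qed.

Lemma tilted_mean_ge0 t A g : (forall x, 0 <= g x)%E -> (0 <= tilted_mean t A g)%E.
Proof. by move=> g0; apply: integral_ge0 => w _; rewrite mule_ge0. Qed.

Lemma le_tilted_mean t A g g' : (forall x, 0 <= g x)%E ->
  (forall w, A w -> g (planar S Z t w) <= g' (planar S Z t w))%E ->
  (tilted_mean t A g <= tilted_mean t A g')%E.
Proof.
move=> g0 gg'; apply: ge0_le_integral_lower => w Aw; first by rewrite mule_ge0.
by rewrite lee_wpmul2r ?gg'// lee_fin expR_ge0.
Qed.

Lemma tilted_meanD t A g g' : 0 <= t -> measurable A ->
  (forall x, 0 <= g x)%E -> (forall x, 0 <= g' x)%E ->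
  measurable_fun setT g -> measurable_fun setT g' ->
  (tilted_mean t A (g \+ g') = tilted_mean t A g + tilted_mean t A g')%E.
Proof.
move=> t0 mA g0 g'0 mg mg'; rewrite /tilted_mean -ge0_integralD//; last 4 first.
- by move=> w _; rewrite mule_ge0.
- by apply: measurable_funTS; exact: measurable_tilted.
- by move=> w _; rewrite mule_ge0.
- by apply: measurable_funTS; exact: measurable_tilted.
by apply: eq_integral => w _; rewrite ge0_muleDl.
Qed.

Lemma tilted_meanU t A B g : 0 <= t -> measurable A -> measurable B ->
  [disjoint A & B] -> (forall x, 0 <= g x)%E -> measurable_fun setT g ->
  (tilted_mean t (A `|` B) g = tilted_mean t A g + tilted_mean t B g)%E.
Proof.
move=> t0 mA mB AB g0 mg; apply: ge0_integral_setU => //.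
  by apply: measurable_funTS; exact: measurable_tilted.
by move=> w _; rewrite mule_ge0.
Qed.

Lemma measurable_tilted_shift t g : 0 <= t -> (forall x, 0 <= g x)%E ->
  measurable_fun setT g -> measurable_fun setT (tilted_shift t g).
Proof.
move=> t0 g0 mg.
pose f (x : (R * R) * T) : \bar R :=
  (g (x.1.1 + S t x.2, x.1.2 + Z t x.2)%R * (expR (th * S t x.2))%:E)%E.
apply: (@measurable_fun_fubini_tonelli_F _ _ _ _ _ P f).
- apply: emeasurable_funM.
    apply: (measurableT_comp mg); apply/measurable_fun_pair;
      apply: measurable_funD.
    + exact: (measurableT_comp measurable_fst measurable_fst).
    + exact: (measurableT_comp (planar_measurable1 L t0) measurable_snd).
    + exact: (measurableT_comp measurable_snd measurable_fst).
    + exact: (measurableT_comp (planar_measurable2 L t0) measurable_snd).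
  exact: (measurableT_comp (measurable_weight t0) measurable_snd).
- by move=> x; rewrite /f mule_ge0.
Qed.

Lemma tilted_shift_ge0 t g x : (forall x, 0 <= g x)%E -> (0 <= tilted_shift t g x)%E.
Proof. by move=> g0; exact: tilted_mean_ge0. Qed.

Lemma tilted_markov h k dl A g : 0 <= h -> 0 <= dl -> grid_past S Z h k A ->
  (forall x, 0 <= g x)%E -> measurable_fun setT g ->
  (tilted_mean (k%:R * h + dl) A g = tilted_mean (k%:R * h) A (tilted_shift dl g))%E.
Proof.
move=> h0 dl0 pA g0 mg.
pose f (x : (R * R) * (R * R)) : \bar R :=
  (g (x.1.1 + x.2.1, x.1.2 + x.2.2)%R * (expR (th * (x.1.1 + x.2.1)))%:E)%E.
have m11 : measurable_fun setT (fun x : (R * R) * (R * R) => x.1.1 + x.2.1).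
  apply: measurable_funD.
    exact: (measurableT_comp measurable_fst measurable_fst).
  exact: (measurableT_comp measurable_fst measurable_snd).
have m22 : measurable_fun setT (fun x : (R * R) * (R * R) => x.1.2 + x.2.2).
  apply: measurable_funD.
    exact: (measurableT_comp measurable_snd measurable_fst).
  exact: (measurableT_comp measurable_snd measurable_snd).
have mf : measurable_fun setT f.
  apply: emeasurable_funM.
    by apply: (measurableT_comp mg); exact/measurable_fun_pair.
  apply/measurable_EFinP; apply: (measurableT_comp (@measurable_expR R)).
  exact: measurable_funM.
have f0 x : (0 <= f x)%E by rewrite /f mule_ge0.
transitivity (\int[P]_(w in A) f (planar S Z (k%:R * h) w,
                       planar_step S Z (k%:R * h) (k%:R * h + dl) w))%E.
  apply: eq_integral => w _; rewrite /f /= /planar.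
  by rewrite !(addrC (_ (k%:R * h) w)) !subrK.
rewrite (markov_step L)//; apply: eq_integral => w _.
rewrite /tilted_shift /tilted_mean -ge0_integralZr//.
- by apply: eq_integral => w' _; rewrite /f /= mulrDr expRD EFinM muleA muleAC.
- apply: emeasurable_funM; last exact: measurable_weight.
  apply: (measurableT_comp mg); apply/measurable_fun_pair; apply: measurable_funD => //.
    exact: planar_measurable1 L _ dl0.
  exact: planar_measurable2 L _ dl0.
- by move=> w' _; rewrite mule_ge0.
Qed.

End tilted_walk.

Section crossing_sums.
Context {dp : measure_display} {T : measurableType dp} {R : realType}.
Variables (P : probability T R) (S Z : R -> T -> R) (th : R).
Hypothesis L : planar_levy P S Z.
Local Notation tmean := (tilted_mean P S Z th).
Local Notation tshift := (tilted_shift P S Z th).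

Variables (h : R) (r : nat).
Hypotheses (h0 : 0 <= h) (rh : r%:R * h = 1).

Let time p : R := (p * r)%:R * h.
Let timeS p : time p + 1 = time p.+1.
Proof. by rewrite /time mulSn natrD addrC mulrDl rh. Qed.
Let grid0 k : 0 <= k%:R * h. Proof. exact: mulr_ge0. Qed.
Let mstays v k : measurable (stays S h v k).
Proof.
case: k => [|k]; first by rewrite stays0.
by apply: (grid_past_measurable L h0 (k := k)); exact: (grid_past_stays L).
Qed.
Let mcrosses v k : measurable (crosses S h v k).
Proof. by apply: (grid_past_measurable L h0 (k := k)); exact: (grid_past_crosses L). Qed.

(* Optional stopping at the first integer time after the first passage of the
   grid walk above [v]. *)
Lemma superharmonic_sum (g d : R * R -> \bar R) (v : R) (n : nat) :
  (forall x, 0 <= g x)%E -> (forall x, 0 <= d x)%E ->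
  measurable_fun setT g -> measurable_fun setT d ->
  (forall x, x.1 <= v -> (tshift 1 g x + d x <= g x)%E) ->
  (\sum_(p < n) (tmean (time p.+1)%R (stays S h v (p * r).+1 `\` stays S h v (p.+1 * r).+1) g
                 + tmean (time p) (stays S h v (p * r).+1) d)
   + tmean (time n) (stays S h v (n * r).+1) g <= g (0, 0)%R)%E.
Proof.
move=> g0 d0 mg md gd; elim: n => [|n IH].
  rewrite big_ord0 add0e /tmean /time mul0n mul0r.
  under eq_integral => w _.
    rewrite /planar (planar_start1 L) (planar_start2 L) mulr0 expR0 mule1.
    over.
  rewrite integral_cst//= -[leRHS]mule1.
  by rewrite lee_wpmul2l// probability_le1.
apply: le_trans IH; rewrite big_ord_recr /= -addeA leeD2l//.
set K := stays _ _ _ (n * r).+1; set K' := stays _ _ _ (n.+1 * r).+1.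
have KK' : K = K `\` K' `|` K'.
  by rewrite setUC setDUK//; apply: sub_stays; rewrite ltnS leq_mul.
rewrite addeAC -(tilted_meanU th L)//; last 4 first.
- exact: grid0.
- exact: measurableD (mstays _ _) (mstays _ _).
- exact: mstays.
- by apply/disj_setPS => w [[]].
rewrite -KK' -timeS (tilted_markov th L)//; last exact: (grid_past_stays L).
rewrite -(tilted_meanD th L)//; last 3 first.
- exact: mstays.
- by move=> x; exact: tilted_shift_ge0.
- exact: measurable_tilted_shift.
apply: le_tilted_mean => [x|w Kw]; first by rewrite adde_ge0// tilted_shift_ge0.
by apply: gd; exact: Kw.
Qed.

Lemma tilted_mean_submartingale (g : R * R -> \bar R) (A : set T) (k i : nat) :
  (forall x, 0 <= g x)%E -> measurable_fun setT g ->
  (forall x, g x <= tshift h g x)%E -> grid_past S Z h k A ->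
  (tmean (k%:R * h) A g <= tmean ((k + i)%:R * h) A g)%E.
Proof.
move=> g0 mg gsub pA; elim: i => [|i IH]; first by rewrite addn0.
apply: (le_trans IH).
have -> : (k + i.+1)%:R * h = (k + i)%:R * h + h by rewrite addnS -natr1 mulrDl mul1r.
rewrite [leRHS](tilted_markov th L)//; last exact: (sub_grid_past (leq_addr _ _)).
by apply: le_tilted_mean => // w _.
Qed.

Lemma tilted_mean_crosses_sum (t v : R) (g : R * R -> \bar R) (m q : nat) :
  0 <= t -> (forall x, 0 <= g x)%E -> measurable_fun setT g ->
  (\sum_(i < q) tmean t (crosses S h v (m + i)) g =
   tmean t (stays S h v m `\` stays S h v (m + q)) g)%E.
Proof.
move=> t0 g0 mg; elim: q => [|q IH].
  by rewrite big_ord0 addn0 setDv /tmean integral_set0.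
rewrite big_ord_recr /= IH -(tilted_meanU th L)//; last 2 first.
- exact: measurableD (mstays _ _) (mstays _ _).
- by apply/disj_setPS => w [[_ /=]] Hn [].
congr (tmean _ _ _); rewrite addnS.
have := staysS_crosses S h v (m + q); have := staysS_crosses_disj S h v (m + q).
have := @sub_stays _ _ _ S h v _ _ (leq_addr q m).
set A := stays _ _ _ m; set B := stays _ _ _ (m + q); set C := stays _ _ _ (m + q).+1.
move=> BA /disj_setPS CD BE; apply/seteqP; split => w.
  case=> [[Aw Bw]|Dw]; split => //.
  - by move=> Cw; apply: Bw; rewrite BE; left.
  - by apply: BA; rewrite BE; right.
  - by move=> Cw; exact: (CD w).
case=> Aw Cw; have [Bw|Bw] := pselect (B w); last by left.
by move: Bw; rewrite BE => -[//|]; right.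
Qed.

Lemma crosses0 v : 0 <= v -> crosses S h v 0 = set0.
Proof.
move=> v0; rewrite -subset0 => w [_ /=].
by rewrite mul0r (planar_start1 L) ltNge v0.
Qed.

Lemma tilted_crosses_le (g G : R * R -> \bar R) (v : R) (n : nat) :
  0 <= v -> (forall x, 0 <= g x)%E -> (forall x, g x <= G x)%E ->
  measurable_fun setT g -> measurable_fun setT G ->
  (forall x, g x <= tshift h g x)%E ->
  (forall x, x.1 <= v -> (tshift 1 G x <= G x)%E) ->
  (\sum_(k < (n * r).+1) tmean (k%:R * h) (crosses S h v k) g <= G (0, 0)%R)%E.
Proof.
move=> v0 g0 gG mg mG gsub Gsup.
have G0 x : (0 <= G x)%E by exact: le_trans (gG x).
have H : (\sum_(p < n) (tmean (time p.+1)%R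
      (stays S h v (p * r).+1 `\` stays S h v (p.+1 * r).+1) G) <= G (0, 0)%R)%E.
  have := @superharmonic_sum G (cst 0%E) v n G0 (fun=> lexx _) mG.
  have m0 : measurable_fun [set: R * R] (cst 0%E : R * R -> \bar R) by exact: measurable_cst.
  move=> /(_ m0) H; apply: le_trans (H _) => [|x xv]; last by rewrite adde0 Gsup.
  apply: (@le_trans _ _ (\sum_(p < n) (tmean (time p.+1)%R
      (stays S h v (p * r).+1 `\` stays S h v (p.+1 * r).+1) G +
      tmean (time p) (stays S h v (p * r).+1) (cst 0)))%E).
    by apply: lee_sum => p _; rewrite leeDl// tilted_mean_ge0.
  by rewrite leeDl// tilted_mean_ge0.
apply: le_trans H; elim: n => [|n IH].
  by rewrite !big_ord_recl !big_ord0 crosses0// /tmean integral_set0 adde0.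
rewrite [leRHS]big_ord_recr /=.
have -> : (n.+1 * r).+1 = ((n * r).+1 + r)%N by rewrite mulSn addSn addnC.
rewrite big_split_ord /=; apply: leeD => //.
rewrite -(@tilted_mean_crosses_sum (time n.+1))//; last exact: grid0.
apply: lee_sum => i _.
apply: (@le_trans _ _ (tmean (time n.+1) (crosses S h v ((n * r).+1 + i)) g)).
  have -> : time n.+1 = ((n * r).+1 + i + (r - i.+1))%:R * h.
    by rewrite /time mulSn addSn -addnS -addnA subnKC ?ltn_ord// addnC.
  apply: tilted_mean_submartingale => //; exact: (grid_past_crosses L).
by apply: le_tilted_mean => // w _.
Qed.

End crossing_sums.

(** * A smooth absolute value *)

Section smooth_abs.
Context {R : realType}.
Implicit Types L x y z : R.

(* [sqrt (L^2 + x^2)]: a convex substitute for [`|x|] whose second order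
   variation is at most [y^2 / (2 L)]. *)
Definition smooth_abs L x : R := Num.sqrt (L ^+ 2 + x ^+ 2).

Lemma sqr_smooth_abs L x : smooth_abs L x ^+ 2 = L ^+ 2 + x ^+ 2.
Proof. by rewrite sqr_sqrtr// addr_ge0 ?sqr_ge0. Qed.

Lemma smooth_abs_ge0 L x : 0 <= smooth_abs L x.
Proof. exact: sqrtr_ge0. Qed.

Lemma smooth_abs0 L : 0 <= L -> smooth_abs L 0 = L.
Proof. by move=> L0; rewrite /smooth_abs expr0n addr0 sqrtr_sqr ger0_norm. Qed.

Lemma smooth_abs_ge L x : 0 <= L -> L <= smooth_abs L x.
Proof.
move=> L0; rewrite -ler_sqr ?nnegrE ?smooth_abs_ge0// sqr_smooth_abs.
by rewrite lerDl sqr_ge0.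
Qed.

Lemma norm_le_smooth_abs L x : `|x| <= smooth_abs L x.
Proof.
by rewrite -ler_sqr ?nnegrE ?smooth_abs_ge0// sqr_smooth_abs real_normK ?num_real// lerDr sqr_ge0.
Qed.

Lemma smooth_abs_tangent L x y : 0 < L ->
  smooth_abs L x + x / smooth_abs L x * y <= smooth_abs L (x + y).
Proof.
move=> L0; set s := smooth_abs L x.
have s0 : 0 < s by apply: lt_le_trans L0 (smooth_abs_ge _ (ltW L0)).
rewrite -(ler_pM2l s0) mulrDr -expr2 sqr_smooth_abs mulrCA mulrA -(mulrA x).
rewrite mulVf ?gt_eqF// mulr1.
rewrite (le_trans (ler_norm _))// -ler_sqr ?nnegrE ?mulr_ge0 ?smooth_abs_ge0//.
rewrite real_normK ?num_real// exprMn !sqr_smooth_abs -subr_ge0.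
have -> : (L ^+ 2 + x ^+ 2) * (L ^+ 2 + (x + y) ^+ 2) - (L ^+ 2 + x ^+ 2 + x * y) ^+ 2
  = (L * y) ^+ 2 by ring.
exact: sqr_ge0.
Qed.

Lemma smooth_abs_le_quadratic L x y : 0 < L ->
  smooth_abs L (x + y) <= smooth_abs L x + x / smooth_abs L x * y + y ^+ 2 / (2 * L).
Proof.
move=> L0; set s := smooth_abs L x.
have sL : L <= s by exact: smooth_abs_ge (ltW L0).
have s0 : 0 < s by exact: lt_le_trans sL.
apply: (@le_trans _ _ (s + x / s * y + y ^+ 2 / (2 * s))); last first.
  rewrite lerD2l ler_wpM2l ?sqr_ge0// lef_pV2 ?posrE ?mulr_gt0//.
  by rewrite ler_pM2l.
have s2 : s ^+ 2 = L ^+ 2 + x ^+ 2 by exact: sqr_smooth_abs.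
have sN0 : s != 0 by rewrite gt_eqF.
have E : s + x / s * y + y ^+ 2 / (2 * s) = (L ^+ 2 + x ^+ 2 + x * y + y ^+ 2 / 2) / s.
  by rewrite -s2; field.
have num0 : 0 <= L ^+ 2 + x ^+ 2 + x * y + y ^+ 2 / 2 by nra.
rewrite E -ler_sqr ?nnegrE ?smooth_abs_ge0 ?divr_ge0 ?(ltW s0)//.
rewrite sqr_smooth_abs expr_div_n s2 ler_pdivlMr -?s2 ?exprn_gt0// s2 -subr_ge0.
have -> : (L ^+ 2 + x ^+ 2 + x * y + y ^+ 2 / 2) ^+ 2 -
  (L ^+ 2 + (x + y) ^+ 2) * (L ^+ 2 + x ^+ 2) = (x * y + y ^+ 2 / 2) ^+ 2 by field.
exact: sqr_ge0.
Qed.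

Lemma smooth_abs_le_linear L x y : 0 < L ->
  smooth_abs L (x + y) <= smooth_abs L x + x / smooth_abs L x * y + 2 * `|y|.
Proof.
move=> L0; set s := smooth_abs L x.
have s0 : 0 < s by apply: lt_le_trans L0 (smooth_abs_ge _ (ltW L0)).
have xs : `|x / s * y| <= `|y|.
  rewrite normrM normrM normfV (ger0_norm (ltW s0)) ler_piMl// ler_pdivrMr// mul1r.
  exact: norm_le_smooth_abs.
have sy : smooth_abs L (x + y) <= s + `|y|.
  rewrite -ler_sqr ?nnegrE ?smooth_abs_ge0 ?addr_ge0 ?(ltW s0)//.
  have s2 : s ^+ 2 = L ^+ 2 + x ^+ 2 by exact: sqr_smooth_abs.
  rewrite sqr_smooth_abs (sqrrD s) s2 real_normK ?num_real//.
  have : x * y <= s * `|y|.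
    rewrite (le_trans (ler_norm _))// normrM ler_wpM2r//; exact: norm_le_smooth_abs.
  rewrite sqrrD; move: (x * y) (s * `|y|) (L ^+ 2) (x ^+ 2) (y ^+ 2).
  by move=> p q a b c H; lra.
move: xs; rewrite ler_norml => /andP[]; move: (x / s * y) (smooth_abs _ _) sy.
by move=> *; lra.
Qed.

Definition smooth_abs_gap L y : R := Num.min (y ^+ 2 / (2 * L)) (2 * `|y|).

Lemma smooth_abs_gap_ge0 L y : 0 <= L -> 0 <= smooth_abs_gap L y.
Proof.
move=> L0; rewrite le_min; apply/andP; split; last by rewrite mulr_ge0.
by rewrite divr_ge0 ?sqr_ge0// mulr_ge0.
Qed.

Lemma smooth_abs_le L x y : 0 < L ->
  smooth_abs L (x + y) <= smooth_abs L x + x / smooth_abs L x * y + smooth_abs_gap L y.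
Proof.
move=> L0; rewrite -lerBlDl le_min !lerBlDl.
by rewrite smooth_abs_le_quadratic// smooth_abs_le_linear.
Qed.

End smooth_abs.

Section dominated.
Context {dp : measure_display} {T : measurableType dp} {R : realType}.
Variable mu : {measure set T -> \bar R}.

Lemma dominated_near (f_ : nat -> T -> R) (f g : T -> R) (e : R) :
  (forall n, measurable_fun setT (f_ n)) ->
  (forall w, f_ n w @[n --> \oo] --> f w) ->
  mu.-integrable setT (EFin \o g) -> (forall n w, `|f_ n w| <= g w) -> 0 < e ->
  \forall n \near \oo,
    `|fine (\int[mu]_w (f w)%:E) - fine (\int[mu]_w (f_ n w)%:E)| < e.
Proof.
move=> mf_ f_f ig fg e0.
have mf_E n : measurable_fun setT (EFin \o f_ n) by exact/measurable_EFinP.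
have f_fE w : setT w -> (EFin \o f_ n) w @[n --> \oo] --> (EFin \o f) w.
  by move=> _; apply: cvg_EFin; [exact: nearW|exact: f_f].
have fgE n w : setT w -> (`|(EFin \o f_ n) w| <= (EFin \o g) w)%E.
  by move=> _; rewrite /= lee_fin.
have mf : measurable_fun setT (EFin \o f) by exact: emeasurable_fun_cvg mf_E f_fE.
have [fi _] := @dominated_convergence _ _ _ mu _ measurableT (fun n => EFin \o f_ n)
  (EFin \o f) _ mf_E mf (aeW _ f_fE) ig (aeW _ (fun w n => fgE n w)).
rewrite -(fineK (integrable_fin_num measurableT fi)) => /fine_cvgP[_ H].
exact: cvgr_dist_lt H _ e0.
Qed.

End dominated.

Section one_step.
Context {dp : measure_display} {T : measurableType dp} {R : realType}.
Variables (P : probability T R) (X Y W : T -> R).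
Hypotheses (mX : measurable_fun setT X) (mY : measurable_fun setT Y)
  (mW : measurable_fun setT W) (W0 : forall w, 0 <= W w).
Hypotheses (W1 : (\int[P]_w (W w)%:E = 1)%E).
Hypotheses (iX : P.-integrable setT (EFin \o (X \* W)))
           (iY : P.-integrable setT (EFin \o (Y \* W))).

Let iW : P.-integrable setT (EFin \o W).
Proof.
apply/integrableP; split; first exact/measurable_EFinP.
by under eq_integral do rewrite /= ger0_norm//; rewrite W1 ltry.
Qed.

Let W1' : \int[P]_w W w = 1. Proof. by rewrite /Rintegral W1. Qed.

Let iZW (a : R) (f : T -> R) : P.-integrable setT (EFin \o (f \* W)) ->
  P.-integrable setT (EFin \o ((cst a \* f) \* W)).
Proof.
move=> /(integrableZl measurableT a); apply: eq_integrable => // w _.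
by rewrite /= -EFinM mulrA.
Qed.

Let iDW (f g : T -> R) : P.-integrable setT (EFin \o (f \* W)) ->
  P.-integrable setT (EFin \o (g \* W)) ->
  P.-integrable setT (EFin \o ((f \+ g) \* W)).
Proof.
move=> /(integrableD measurableT)/[apply]; apply: eq_integrable => // w _.
by rewrite /= -EFinD mulrDl.
Qed.

Let icW (a : R) : P.-integrable setT (EFin \o (cst a \* W)).
Proof.
by have := integrableZl measurableT a iW; apply: eq_integrable => // w _ /=.
Qed.

Let le_iW (f g : T -> R) : measurable_fun setT f ->
  (forall w, `|f w| <= g w) -> P.-integrable setT (EFin \o (g \* W)) ->
  P.-integrable setT (EFin \o (f \* W)).
Proof.
move=> mf fg ig; apply: (le_integrable measurableT _ _ ig).
  by apply/measurable_EFinP; exact: measurable_funM.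
by move=> w _ /=; rewrite lee_fin !normrM ler_wpM2r// (le_trans (fg w))// ler_norm.
Qed.

Let iNW (f : T -> R) : P.-integrable setT (EFin \o (f \* W)) ->
  P.-integrable setT (EFin \o ((fun w => `|f w|) \* W)).
Proof.
move=> /(integrable_norm); apply: eq_integrable => // w _ /=.
by rewrite normrM (ger0_norm (W0 w)).
Qed.

Let WintegralD (f g : T -> R) : P.-integrable setT (EFin \o (f \* W)) ->
  P.-integrable setT (EFin \o (g \* W)) ->
  \int[P]_w ((f w + g w) * W w) = \int[P]_w (f w * W w) + \int[P]_w (g w * W w).
Proof.
by move=> fi gi; rewrite -RintegralD//; apply: eq_Rintegral => w _; rewrite mulrDl.
Qed.

Let WintegralZ (a : R) (f : T -> R) : P.-integrable setT (EFin \o (f \* W)) ->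
  \int[P]_w ((a * f w) * W w) = a * \int[P]_w (f w * W w).
Proof.
by move=> fi; rewrite -RintegralZl//; apply: eq_Rintegral => w _; rewrite mulrA.
Qed.

Let Wintegral_cst (a : R) : \int[P]_w (a * W w) = a.
Proof. by rewrite RintegralZl// W1' mulr1. Qed.

Let WintegralE (f : T -> R) : P.-integrable setT (EFin \o (f \* W)) ->
  (\int[P]_w (f w * W w)%:E)%E = (\int[P]_w (f w * W w))%:E.
Proof. by move=> fi; rewrite /Rintegral fineK//; exact: integrable_fin_num. Qed.

Let le_Wintegral (f g : T -> R) : P.-integrable setT (EFin \o (f \* W)) ->
  P.-integrable setT (EFin \o (g \* W)) -> (forall w, f w <= g w) ->
  \int[P]_w (f w * W w) <= \int[P]_w (g w * W w).
Proof.
by move=> fi gi fg; apply: le_Rintegral => // w _; rewrite ler_wpM2r.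
Qed.

Let m_smooth_abs L a : measurable_fun setT (fun w => smooth_abs L (a + Y w)).
Proof.
apply: (measurableT_comp (continuous_measurable_fun (@sqrt_continuous R))).
by apply: measurable_funD => //; apply: measurable_funX; exact: measurable_funD.
Qed.

Let i_smooth_abs L a : 0 < L ->
  P.-integrable setT (EFin \o ((fun w => smooth_abs L (a + Y w)) \* W)).
Proof.
move=> L0; apply: (@le_iW _ ((cst (smooth_abs L a)) \+ (cst 3 \* (fun w => `|Y w|)))) => //.
  move=> w /=; rewrite ger0_norm ?smooth_abs_ge0//.
  apply: (le_trans (smooth_abs_le_linear _ _ L0)).
  have s0 : 0 < smooth_abs L a by apply: lt_le_trans L0 (smooth_abs_ge _ (ltW L0)).
  have : a / smooth_abs L a * Y w <= `|Y w|.
    rewrite (le_trans (ler_norm _))// normrM normrM normfV (ger0_norm (ltW s0)).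
    by rewrite ler_piMl// ler_pdivrMr// mul1r norm_le_smooth_abs.
  lra.
by apply: iDW => //; apply: iZW; exact: iNW.
Qed.

Lemma smooth_abs_jensen L a : 0 < L -> \int[P]_w (Y w * W w) = 0 ->
  ((smooth_abs L a)%:E <= \int[P]_w (smooth_abs L (a + Y w) * W w)%:E)%E.
Proof.
move=> L0 Y0; rewrite (WintegralE (i_smooth_abs a L0)) lee_fin.
set c := a / smooth_abs L a.
have ic : P.-integrable setT (EFin \o ((cst (smooth_abs L a) \+ (cst c \* Y)) \* W)).
  by apply: iDW => //; exact: iZW.
apply: le_trans (le_Wintegral ic (i_smooth_abs a L0) _); last first.
  by move=> w; exact: smooth_abs_tangent.
by rewrite WintegralD//; [rewrite Wintegral_cst WintegralZ// Y0 mulr0 addr0|exact: iZW].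
Qed.

Let m_gap L : measurable_fun setT (fun w => smooth_abs_gap L (Y w)).
Proof.
apply: measurable_minr; apply: measurable_funM => //.
  exact: measurable_funX.
exact: (measurableT_comp (@normr_measurable R setT)).
Qed.

Let i_gap L : 0 <= L -> P.-integrable setT (EFin \o ((fun w => smooth_abs_gap L (Y w)) \* W)).
Proof.
move=> L0; apply: (@le_iW _ (cst 2 \* (fun w => `|Y w|))) => //.
  by move=> w; rewrite ger0_norm ?smooth_abs_gap_ge0// ge_min lexx orbT.
by apply: iZW; exact: iNW.
Qed.

Lemma smooth_abs_gap_small (e : R) : 0 < e ->
  exists2 L, 0 < L & \int[P]_w (smooth_abs_gap L (Y w) * W w) <= e.
Proof.
move=> e0; pose f_ (n : nat) w := smooth_abs_gap n.+1%:R (Y w) * W w.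
have mf_ n : measurable_fun setT (f_ n) by apply: measurable_funM.
have f_0 w : f_ n w @[n --> \oo] --> (cst 0 : T -> R) w.
  apply: (@squeeze_cvgr _ _ _ _ (cst 0) (fun n => (Y w ^+ 2 / 2 * W w) * n.+1%:R^-1)).
  - apply: nearW => n; rewrite mulr_ge0 ?smooth_abs_gap_ge0//=.
    rewrite /f_ [leRHS]mulrAC ler_wpM2r//.
    by rewrite -mulrA -invfM; rewrite ge_min lexx.
  - exact: cvg_cst.
  - rewrite -[X in _ --> X](mulr0 (Y w ^+ 2 / 2 * W w)); apply: cvgMr.
    exact: cvg_harmonic.
have ig : P.-integrable setT (EFin \o (fun w => 2 * `|Y w| * W w)).
  exact: iZW (iNW iY).
have fg n w : `|f_ n w| <= 2 * `|Y w| * W w.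
  rewrite normrM (ger0_norm (W0 w)) ler_wpM2r// ger0_norm ?smooth_abs_gap_ge0//.
  by rewrite ge_min lexx orbT.
have [n _ /(_ n (leqnn n)) Hn] := dominated_near mf_ f_0 ig fg e0.
exists n.+1%:R => //; apply/ltW; move: Hn.
rewrite integral0 /= sub0r normrN; apply: le_lt_trans; exact: ler_norm.
Qed.

Let m_min K : measurable_fun setT (fun w => Num.min (X w) K).
Proof. exact: measurable_minr. Qed.

Let i_min K : 0 <= K -> P.-integrable setT (EFin \o ((fun w => Num.min (X w) K) \* W)).
Proof.
move=> K0; apply: (@le_iW _ (fun w => `|X w|)) => //; last exact: iNW.
by move=> w; rewrite /Num.min; case: ifPn => //; rewrite -leNgt (ger0_norm K0) => /le_trans; apply; exact: ler_norm.
Qed.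

Lemma truncated_mean_near (e : R) : 0 < e ->
  exists2 K, 0 < K & \int[P]_w (X w * W w) - e <= \int[P]_w (Num.min (X w) K * W w).
Proof.
move=> e0; pose f_ (n : nat) w := Num.min (X w) n.+1%:R * W w.
have mf_ n : measurable_fun setT (f_ n) by apply: measurable_funM.
have f_X w : f_ n w @[n --> \oo] --> (X \* W) w.
  apply: cvg_near_cst; near=> n; rewrite /f_ /= min_l//.
  rewrite (le_trans (ler_norm _))// (le_trans (ltW (truncnS_gt _)))// ler_nat ltnS.
  near: n; exact: nbhs_infty_ge.
have ig : P.-integrable setT (EFin \o (fun w => `|X w| * W w)) by exact: iNW.
have fg n w : `|f_ n w| <= `|X w| * W w.
  rewrite normrM (ger0_norm (W0 w)) ler_wpM2r// /Num.min; case: ifPn => //.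
  by rewrite -leNgt ger0_norm// => /le_trans; apply; exact: ler_norm.
have [n _ /(_ n (leqnn n)) Hn] := dominated_near mf_ f_X ig fg e0.
exists n.+1%:R => //; move: Hn; rewrite ltr_norml => /andP[_ /ltW].
by rewrite -/(Rintegral _ _ _) -/(Rintegral _ _ _); lra.
Unshelve. all: by end_near. Qed.

Lemma tail_mean_small (e : R) (B0 : R) : 0 < e ->
  exists2 B, B0 <= B &
    (\int[P]_w (`|X w| * \1_[set w | (B < X w)%R] w * W w)%:E <= e%:E)%E.
Proof.
move=> e0; pose b (n : nat) : R := Num.max B0 n%:R.
pose f_ (n : nat) w := `|X w| * \1_[set w | b n < X w] w * W w.
have mI n : measurable [set w | b n < X w].
  rewrite -[X in measurable X]setTI.
  have -> : [set w | b n < X w] = X @^-1` `]b n, +oo[%classic.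
    by apply/seteqP; split => x /=; rewrite in_itv/= andbT.
  exact: mX.
have mf_ n : measurable_fun setT (f_ n).
  apply: measurable_funM => //; apply: measurable_funM.
    exact: (measurableT_comp (@normr_measurable R setT)).
  exact: measurable_indic.
have f_0 w : f_ n w @[n --> \oo] --> (cst 0 : T -> R) w.
  apply: cvg_near_cst; near=> n; rewrite /f_ indicE memNset ?mulr0 ?mul0r//=.
  apply/negP; rewrite -leNgt le_max; apply/orP; right.
  rewrite (le_trans (ler_norm _))// (le_trans (ltW (truncnS_gt _)))// ler_nat.
  near: n; exact: nbhs_infty_gt.
have ig : P.-integrable setT (EFin \o (fun w => `|X w| * W w)) by exact: iNW.
have f0 n w : 0 <= f_ n w by rewrite !mulr_ge0.
have fg n w : `|f_ n w| <= `|X w| * W w.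
  rewrite ger0_norm// ler_wpM2r// ler_piMr// indicE; by case: (_ \in _).
have [n _ /(_ n (leqnn n)) Hn] := dominated_near mf_ f_0 ig fg e0.
exists (b n); first by rewrite le_max lexx.
rewrite (@WintegralE (fun w => `|X w| * \1_[set w | b n < X w] w)); last first.
  apply: (@le_iW _ (fun w => `|X w|)); last exact: iNW.
    apply: measurable_funM; last exact: measurable_indic.
    exact: (measurableT_comp (@normr_measurable R setT)).
  by move=> w; rewrite normrM normr_id ler_piMr// indicE; case: (_ \in _); rewrite ?normr1 ?normr0.
rewrite lee_fin; apply/ltW; move: Hn.
rewrite integral0 /= sub0r normrN; apply: le_lt_trans; exact: ler_norm.
Unshelve. all: by end_near. Qed.

Lemma distance_below_drift (K s v : R) : 0 <= K -> s <= v ->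
  (\int[P]_w (Num.max (v + K - (s + X w)) 0 * W w)%:E +
     (\int[P]_w (Num.min (X w) K * W w))%:E <= (Num.max (v + K - s) 0)%:E)%E.
Proof.
move=> K0 sv.
have bound w : Num.max (v + K - (s + X w)) 0 <= (v + K - s) + -1 * Num.min (X w) K.
  by rewrite /Num.max /Num.min; do 2 case: ifPn; rewrite -?leNgt => *; lra.
have ib : P.-integrable setT (EFin \o ((cst (v + K - s) \+
    (cst (-1) \* (fun w => Num.min (X w) K))) \* W)).
  by apply: iDW => //; apply: iZW; exact: i_min.
have im : P.-integrable setT (EFin \o ((fun w => Num.max (v + K - (s + X w)) 0) \* W)).
  apply: (@le_iW _ (cst (v + K - s) \+ (fun w => `|X w|))) => //.
  - apply: measurable_maxr => //; apply: measurable_funB => //; exact: measurable_funD.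
  - move=> w /=; rewrite ger0_norm ?le_max ?lexx ?orbT// ge_max; apply/andP; split.
      by have := ler_norm (- X w); rewrite normrN; lra.
    by have := normr_ge0 (X w); lra.
  - by apply: iDW => //; exact: iNW.
rewrite WintegralE// -EFinD lee_fin max_l; last by lra.
rewrite -lerBrDr; apply: le_trans (le_Wintegral im ib bound) _.
rewrite WintegralD//; last by apply: iZW; exact: i_min.
by rewrite Wintegral_cst WintegralZ ?mulN1r//; exact: i_min.
Qed.

Lemma smooth_abs_potential (e : R) : 0 < e -> \int[P]_w (Y w * W w) = 0 ->
  0 < \int[P]_w (X w * W w) ->
  exists L K : R, [/\ 0 < L, 0 < K & forall a s v, s <= v ->
    (\int[P]_w ((smooth_abs L (a + Y w) + e * Num.max (v + K - (s + X w)) 0) * W w)%:E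
     <= (smooth_abs L a + e * Num.max (v + K - s) 0)%:E)%E].
Proof.
move=> e0 Y0; set m := Rintegral _ _ _ => m0.
have m20 : 0 < m / 2 by rewrite divr_gt0.
have [K K0 HK'] := truncated_mean_near m20.
have HK : m / 2 <= \int[P]_w (Num.min (X w) K * W w).
  by apply: le_trans HK'; rewrite lerBrDr -splitr.
have [L L0 HL] := smooth_abs_gap_small (mulr_gt0 e0 m20).
exists L, K; split => // a s v sv.
set c := a / smooth_abs L a.
have mmax : measurable_fun setT (fun w => Num.max (v + K - (s + X w)) 0).
  by apply: measurable_maxr => //; apply: measurable_funB => //; exact: measurable_funD.
have mx0 w : 0 <= Num.max (v + K - (s + X w)) 0 * W w.
  by rewrite mulr_ge0// le_max lexx orbT.
under eq_integral do rewrite mulrDl EFinD -mulrA (EFinM e).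
rewrite ge0_integralD//; last 4 first.
- by move=> w _; rewrite lee_fin mulr_ge0// smooth_abs_ge0.
- by apply/measurable_EFinP; exact: measurable_funM.
- by move=> w _; rewrite -EFinM lee_fin mulr_ge0// ltW.
- by apply/measurable_EFinP; apply: measurable_funM => //; exact: measurable_funM.
rewrite ge0_integralZl_EFin ?(ltW e0)//; last 2 first.
- by move=> w _; rewrite lee_fin.
- by apply/measurable_EFinP; exact: measurable_funM.
have H1 : (\int[P]_w (smooth_abs L (a + Y w) * W w)%:E <= (smooth_abs L a + e * (m / 2))%:E)%E.
  rewrite (WintegralE (i_smooth_abs a L0)) lee_fin.
  have ib : P.-integrable setT (EFin \o (((cst (smooth_abs L a) \+ (cst c \* Y)) \+
      (fun w => smooth_abs_gap L (Y w))) \* W)).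
    by apply: iDW; [apply: iDW => //; exact: iZW|exact: i_gap (ltW L0)].
  apply: (le_trans (le_Wintegral (i_smooth_abs a L0) ib _)).
    by move=> w; exact: smooth_abs_le.
  rewrite WintegralD; [|by apply: iDW => //; exact: iZW|exact: i_gap (ltW L0)].
  rewrite WintegralD//; last exact: iZW.
  by rewrite Wintegral_cst WintegralZ// Y0 mulr0 addr0 lerD2l.
have := distance_below_drift (ltW K0) sv.
set I := integral _ _ _ => H2.
have I0 : (0 <= I)%E.
  by apply: integral_ge0 => w _; rewrite lee_fin mulr_ge0// le_max lexx orbT.
have Ifin : I \is a fin_num.
  rewrite ge0_fin_numE//; apply: (@le_lt_trans _ _ (Num.max (v + K - s) 0)%:E); last exact: ltry.
  apply: le_trans H2; by rewrite leeDl// lee_fin (le_trans (ltW m20)).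
move: H2; rewrite -(fineK Ifin) -EFinD lee_fin => H2.
apply: (@le_trans _ _ ((smooth_abs L a + e * (m / 2))%:E + e%:E * (fine I)%:E)%E).
  exact: leeD.
rewrite -EFinM -EFinD lee_fin -addrA lerD2l -mulrDr ler_pM2l//.
apply: le_trans H2; by rewrite [leLHS]addrC lerD2l.
Qed.

End one_step.

(** * Crossings of a level on grids *)

Section tilted_levy.
Context {dp : measure_display} {T : measurableType dp} {R : realType}.
Variables (P : probability T R) (S Z : R -> T -> R) (th : R).
Hypothesis L : planar_levy P S Z.
Hypothesis th_mean : forall t, 0 <= t -> (\int[P]_w (expR (th * S t w))%:E = 1)%E.
Local Notation tmean := (tilted_mean P S Z th).
Local Notation tshift := (tilted_shift P S Z th).
Local Notation weight t := (fun w => expR (th * S t w)).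

Definition tilted_centered (t : R) : Prop :=
  P.-integrable setT (EFin \o (Z t \* weight t)) /\
  \int[P]_w (Z t w * expR (th * S t w)) = 0.

Let mw t : 0 <= t -> measurable_fun setT (weight t).
Proof.
move=> t0; apply: (measurableT_comp (@measurable_expR R)).
by apply: measurable_funM => //; exact: planar_measurable1 L _ t0.
Qed.

Let mZ t : 0 <= t -> measurable_fun setT (Z t).
Proof. by move=> t0; exact: planar_measurable2 L _ t0. Qed.

Let integral_step_prod t (f1 f2 : R * R -> R) : 0 <= t ->
  (forall x, 0 <= f1 x) -> (forall x, 0 <= f2 x) ->
  measurable_fun setT f1 -> measurable_fun setT f2 ->
  (\int[P]_w (f1 (planar S Z t w) * f2 (planar_step S Z t (t + t) w))%:E =
   \int[P]_w (f1 (planar S Z t w))%:E * \int[P]_w (f2 (planar S Z t w))%:E)%E.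
Proof.
move=> t0 f10 f20 mf1 mf2.
pose f (x : (R * R) * (R * R)) : \bar R := (f1 x.1 * f2 x.2)%:E.
have mf : measurable_fun setT f.
  apply/measurable_EFinP; apply: measurable_funM.
    exact: (measurableT_comp mf1 measurable_fst).
  exact: (measurableT_comp mf2 measurable_snd).
have f0 x : (0 <= f x)%E by rewrite lee_fin mulr_ge0.
have pT : grid_past S Z t 1 setT by apply: sub_sigma_algebra; exact: grid_boxesT.
have := markov_step L t0 t0 pT f0 mf; rewrite mul1r /f /= => ->.
have mU := measurable_planar L t0.
have m2 : measurable_fun setT (fun w => (f2 (planar S Z t w))%:E).
  by apply/measurable_EFinP; exact: (measurableT_comp mf2 mU).
have m1 : measurable_fun setT (fun w => (f1 (planar S Z t w))%:E).
  by apply/measurable_EFinP; exact: (measurableT_comp mf1 mU).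
under eq_integral do under eq_integral do rewrite EFinM.
under eq_integral => w _.
  rewrite ge0_integralZl_EFin//; last by move=> w' _; rewrite lee_fin.
  over.
rewrite ge0_integralZr//; first by move=> w _; rewrite lee_fin.
by apply: integral_ge0 => w _; rewrite lee_fin.
Qed.

Let integrable_weight t : 0 <= t -> P.-integrable setT (EFin \o weight t).
Proof.
move=> t0; apply/integrableP; split; first by apply/measurable_EFinP; exact: mw.
under eq_integral do rewrite /= ger0_norm//.
by rewrite th_mean// ltry.
Qed.

Let fst_expR_measurable : measurable_fun setT (fun x : R * R => expR (th * x.1)).
Proof.
by apply: (measurableT_comp (@measurable_expR R)); exact: measurable_funM.
Qed.

(* Since the two halves [A], [B] of [Z (2 t)] are independent, restricting to
   [`|B| <= b] bounds [`|A|] by [`|Z (2 t)| + b]. *)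
Let half_integrable t : 0 <= t ->
  P.-integrable setT (EFin \o (Z (t + t) \* weight (t + t))) ->
  P.-integrable setT (EFin \o (Z t \* weight t)).
Proof.
move=> t0 i2; have tt0 : 0 <= t + t by rewrite addr_ge0.
have [b q_gt0] : exists b : R,
    (0 < \int[P]_w (\1_[set x : R * R | `|x.2| <= b] (planar S Z t w) *
                   expR (th * S t w))%:E)%E.
  pose f_ (n : nat) w := \1_[set x : R * R | `|x.2| <= n%:R] (planar S Z t w) * expR (th * S t w).
  have mA n : measurable [set x : R * R | `|x.2| <= n%:R].
    rewrite -[X in measurable X]setTI.
    have -> : [set x : R * R | `|x.2| <= n%:R] =
        (fun x : R * R => `|x.2|) @^-1` `]-oo, n%:R]%classic.
      by apply/seteqP; split => x /=; rewrite in_itv.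
    exact: (measurableT_comp (@normr_measurable R setT) measurable_snd).
  have mf_ n : measurable_fun setT (f_ n).
    apply: measurable_funM; last exact: mw.
    apply: (measurableT_comp _ (measurable_planar L t0)).
    exact: measurable_indic.
  have f_f w : f_ n w @[n --> \oo] --> (weight t) w.
    apply: cvg_near_cst; near=> n; rewrite /f_ indicE mem_set ?mul1r//=.
    rewrite (le_trans (ltW (truncnS_gt _)))// ler_nat.
    near: n; exact: nbhs_infty_gt.
  have fg n w : `|f_ n w| <= weight t w.
    by rewrite normrM (ger0_norm (expR_ge0 _)) ler_piMl// indicE; case: (_ \in _); rewrite ?normr1 ?normr0.
  have half0 : (0 < 2^-1 :> R) by rewrite invr_gt0.
  have [n _ /(_ n (leqnn n)) Hn] := dominated_near mf_ f_f (integrable_weight t0) fg half0.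
  exists n%:R; move: Hn; rewrite th_mean//= -/(f_ n) => Hn.
  rewrite lt_neqAle eq_sym integral_ge0 ?andbT; last by move=> w _; rewrite lee_fin mulr_ge0.
  apply/eqP => H; move: Hn; rewrite /f_ H/= subr0 normr1; lra.
have bM : measurable_fun setT (\1_[set x : R * R | `|x.2| <= b] : R * R -> R).
  apply: measurable_indic; rewrite -[X in measurable X]setTI.
  have -> : [set x : R * R | `|x.2| <= b] = (fun x : R * R => `|x.2|) @^-1` `]-oo, b]%classic.
    by apply/seteqP; split => x /=; rewrite in_itv.
  exact: (measurableT_comp (@normr_measurable R setT) measurable_snd).
pose f1 (x : R * R) : R := `|x.2| * expR (th * x.1).
pose f2 (x : R * R) : R := \1_[set x : R * R | `|x.2| <= b] x * expR (th * x.1).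
have mf1 : measurable_fun setT f1.
  apply: measurable_funM => //.
  exact: (measurableT_comp (@normr_measurable R setT) measurable_snd).
have mf2 : measurable_fun setT f2 by exact: measurable_funM.
have f10 x : 0 <= f1 x by rewrite mulr_ge0.
have f20 x : 0 <= f2 x by rewrite mulr_ge0.
have mZw s : 0 <= s -> measurable_fun setT (EFin \o (Z s \* weight s)).
  by move=> s0; apply/measurable_EFinP; apply: measurable_funM; [exact: mZ|exact: mw].
apply/integrableP; split; first exact: mZw.
have := integral_step_prod t0 f10 f20 mf1 mf2.
set q := (\int[P]_w (f2 _)%:E)%E => prodE.
have ub : (\int[P]_w (f1 (planar S Z t w) * f2 (planar_step S Z t (t + t) w))%:E < +oo)%E.
  have ib : P.-integrable setT
      (fun w => ((`|Z (t + t) w| + `|b|) * expR (th * S (t + t) w))%:E).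
    have := integrableD measurableT (integrable_norm i2)
      (integrableZl measurableT `|b| (integrable_weight tt0)).
    apply: eq_integrable => // w _ /=.
    by rewrite normrM (ger0_norm (expR_ge0 _)) -EFinM -EFinD mulrDl.
  apply: le_lt_trans (integrable_lty measurableT ib).
  apply: ge0_le_integral_lower => w _; first by rewrite lee_fin mulr_ge0.
  rewrite lee_fin /f1 /f2 /planar /planar_step /= indicE.
  have [|_] := boolP (_ \in _); last by rewrite mul0r mulr0 mulr_ge0// addr_ge0.
  rewrite inE /= mul1r => Zb.
  rewrite -mulrA -expRD -mulrDr [S t w + _]addrC subrK ler_wpM2r//.
  have -> : Z t w = Z (t + t) w - (Z (t + t) w - Z t w) by ring.
  rewrite (le_trans (ler_normB _ _))// lerD2l.
  by rewrite (le_trans Zb)// ler_norm.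
have EE : (\int[P]_w `|(EFin \o (Z t \* weight t)%R) w| = \int[P]_w (f1 (planar S Z t w))%:E)%E.
  by apply: eq_integral => w _; rewrite /= normrM (ger0_norm (expR_ge0 _)).
rewrite EE ltNge leye_eq; apply/negP => /eqP infty.
by move: ub; rewrite prodE infty gt0_mulye// ltxx.
Unshelve. all: by end_near. Qed.

Let half_mean t : 0 <= t -> P.-integrable setT (EFin \o (Z t \* weight t)) ->
  \int[P]_w (Z (t + t) w * expR (th * S (t + t) w)) =
  \int[P]_w (Z t w * expR (th * S t w)) *+ 2.
Proof.
move=> t0 i1; have tt0 : 0 <= t + t by rewrite addr_ge0.
pose e (x : R * R) : R := expR (th * x.1).
pose p (x : R * R) : R := Num.max x.2 0 * expR (th * x.1).
pose n (x : R * R) : R := Num.max (- x.2) 0 * expR (th * x.1).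
have me : measurable_fun setT e by [].
have mp : measurable_fun setT p.
  by apply: measurable_funM => //; exact: measurable_maxr.
have mn : measurable_fun setT n.
  by apply: measurable_funM => //; apply: measurable_maxr => //; exact: measurableT_comp.
have e0 x : 0 <= e x by exact: expR_ge0.
have p0 x : 0 <= p x by rewrite mulr_ge0// le_max lexx orbT.
have n0 x : 0 <= n x by rewrite mulr_ge0// le_max lexx orbT.
pose U := planar S Z t; pose V := planar_step S Z t (t + t).
have mU : measurable_fun setT U := measurable_planar L t0.
have mV : measurable_fun setT V := measurable_planar_step L t0 tt0.
have pn x : p x - n x = x.2 * e x.
  by rewrite -mulrBl; congr (_ * _); rewrite /Num.max; do 2 case: ifPn; rewrite -?leNgt => *; lra.
have iabs (f : R * R -> R) : measurable_fun setT f -> (forall x, 0 <= f x) ->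
    (forall x, f x <= `|x.2 * e x|) -> P.-integrable setT (EFin \o (f \o U)).
  move=> mf f0 fx; apply: (le_integrable measurableT _ _ i1).
    by apply/measurable_EFinP; exact: measurableT_comp.
  by move=> w _; rewrite /= lee_fin (ger0_norm (f0 _)) fx.
have ip : P.-integrable setT (EFin \o (p \o U)).
  apply: iabs => // x; rewrite normrM (ger0_norm (e0 _)) ler_wpM2r// ge_max normr_ge0.
  by rewrite ler_norm.
have in_ : P.-integrable setT (EFin \o (n \o U)).
  apply: iabs => // x; rewrite normrM (ger0_norm (e0 _)) ler_wpM2r// ge_max normr_ge0.
  by rewrite -normrN ler_norm.
have ie : P.-integrable setT (EFin \o (e \o U)) by exact: integrable_weight.
have e1 : (\int[P]_w (e (U w))%:E = 1)%E by exact: th_mean.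
have prod (f1 f2 : R * R -> R) : (forall x, 0 <= f1 x) -> (forall x, 0 <= f2 x) ->
    measurable_fun setT f1 -> measurable_fun setT f2 ->
    P.-integrable setT (EFin \o (f1 \o U)) -> P.-integrable setT (EFin \o (f2 \o U)) ->
    P.-integrable setT (EFin \o (fun w => f1 (U w) * f2 (V w))) /\
    \int[P]_w (f1 (U w) * f2 (V w)) = \int[P]_w f1 (U w) * \int[P]_w f2 (U w).
  move=> f10 f20 mf1 mf2 i_1 i_2.
  have H := integral_step_prod t0 f10 f20 mf1 mf2.
  split.
    apply/integrableP; split.
      by apply/measurable_EFinP; apply: measurable_funM; exact: measurableT_comp.
    under eq_integral do rewrite /= ger0_norm ?mulr_ge0//.
    rewrite [ltLHS]H -(fineK (integrable_fin_num measurableT i_1)).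
    by rewrite -(fineK (integrable_fin_num measurableT i_2)) -EFinM ltry.
  rewrite /Rintegral [X in fine X]H fineM//; exact: integrable_fin_num.
have [ipe Ipe] := prod p e p0 e0 mp me ip ie.
have [ine Ine] := prod n e n0 e0 mn me in_ ie.
have [iep Iep] := prod e p e0 p0 me mp ie ip.
have [ien Ien] := prod e n e0 n0 me mn ie in_.
have Re : \int[P]_w e (U w) = 1 by rewrite /Rintegral e1.
have -> : \int[P]_w (Z (t + t) w * expR (th * S (t + t) w)) =
   \int[P]_w ((p (U w) * e (V w) - n (U w) * e (V w)) +
              (e (U w) * p (V w) - e (U w) * n (V w))).
  apply: eq_Rintegral => w _.
  rewrite -mulrBl -mulrBr !pn mulrCA -mulrA -mulrDl.
  by rewrite /e -expRD -mulrDr /U /V /planar /planar_step/= ![_ t w + (_ - _)]addrC !subrK.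
have -> : \int[P]_w (Z t w * expR (th * S t w)) = \int[P]_w (p (U w)) - \int[P]_w (n (U w)).
  by rewrite -RintegralB//; apply: eq_Rintegral => w _; rewrite pn.
rewrite RintegralD//; [|exact: (integrableB measurableT ipe ine)|exact: (integrableB measurableT iep ien)].
by rewrite !RintegralB// Ipe Ine Iep Ien Re !mulr1 !mul1r mulr2n.
Qed.

Lemma tilted_centered_half t : 0 <= t -> tilted_centered (t + t) -> tilted_centered t.
Proof.
move=> t0 [i2 m2]; have i1 := half_integrable t0 i2; split => //.
by move: m2; rewrite half_mean// => /eqP; rewrite mulrn_eq0 => /eqP.
Qed.

Lemma tilted_centered_dyadic j : tilted_centered 1 -> tilted_centered (2 ^- j).
Proof.
move=> c1; elim: j => [|j IH]; first by rewrite expr0 invr1.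
apply: tilted_centered_half; first by rewrite invr_ge0 exprn_ge0.
suff -> : 2 ^- j.+1 + 2 ^- j.+1 = 2 ^- j :> R by [].
by rewrite exprS invfM; move: (2 ^- j) => a; lra.
Qed.

End tilted_levy.

Section crossing_bounds.
Context {dp : measure_display} {T : measurableType dp} {R : realType}.
Variables (P : probability T R) (S Z : R -> T -> R) (th : R).
Hypothesis L : planar_levy P S Z.
Hypothesis th0 : 0 < th.
Hypothesis th_mean : forall t, 0 <= t -> (\int[P]_w (expR (th * S t w))%:E = 1)%E.
Local Notation tmean := (tilted_mean P S Z th).
Local Notation tshift := (tilted_shift P S Z th).
Local Notation weight t := (fun w => expR (th * S t w)).

Let mw t : 0 <= t -> measurable_fun setT (weight t).
Proof.
move=> t0; apply: (measurableT_comp (@measurable_expR R)).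
by apply: measurable_funM => //; exact: planar_measurable1 L _ t0.
Qed.

Let dyadic0 j : 0 <= 2 ^- j :> R. Proof. by rewrite invr_ge0 exprn_ge0. Qed.

Let dyadic1 j : (2 ^ j)%N%:R * 2 ^- j = 1 :> R.
Proof. by rewrite natrX mulfV// expf_neq0. Qed.

Lemma sum_crosses_le j (g G : R * R -> \bar R) (F : R -> T -> R) (v : R) (N : nat) :
  0 <= v -> (forall x, 0 <= g x)%E -> (forall x, g x <= G x)%E ->
  measurable_fun setT g -> measurable_fun setT G ->
  (forall x, g x <= tshift (2 ^- j) g x)%E ->
  (forall x, x.1 <= v -> (tshift 1 G x <= G x)%E) ->
  (forall t w, 0 <= F t w) ->
  (forall t w, v < S t w -> ((expR (th * v) * F t w)%:E <=
     g (planar S Z t w) * (expR (th * S t w))%:E)%E) ->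
  ((expR (th * v))%:E * \sum_(k < N) \int[P]_(w in crosses S (2 ^- j) v k) (F (k%:R * 2 ^- j)%R w)%:E
   <= G (0, 0)%R)%E.
Proof.
move=> v0 g0 gG mg mG gsub Gsup F0 Fg.
have := tilted_crosses_le L (dyadic0 j) (dyadic1 j) N v0 g0 gG mg mG gsub Gsup.
apply: le_trans; rewrite ge0_sume_distrr; last first.
  by move=> k _; apply: integral_ge0 => w _; rewrite lee_fin.
apply: (@le_trans _ _ (\sum_(k < N) tmean (k%:R * 2 ^- j)%R (crosses S (2 ^- j) v k) g)%E).
  apply: lee_sum => k _.
  rewrite integral_mkcond -ge0_integralZl_lower ?expR_ge0//; last first.
    by move=> w; apply: erestrict_ge0 => ? _; rewrite lee_fin.
  rewrite /tilted_mean [leRHS]integral_mkcond; apply: ge0_le_integral_lower => w _.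
    by rewrite mule_ge0 ?lee_fin ?expR_ge0//; apply: erestrict_ge0 => ? _; rewrite lee_fin.
  rewrite /patch; case: ifPn => [|_]; last by rewrite mule0.
  by rewrite inE => -[_ /= Sv]; rewrite -EFinM; exact: Fg.
have -> : ((N * 2 ^ j).+1 = N + ((N * 2 ^ j).+1 - N))%N.
  by rewrite subnKC// (leq_trans (leqnSn _))// ltnS leq_pmulr// expn_gt0.
rewrite big_split_ord /= leeDl// sume_ge0// => k _; exact: tilted_mean_ge0.
Qed.

Lemma tilted_shift1 t x : 0 <= t -> tshift t (cst 1%E) x = 1%E.
Proof.
by move=> t0; rewrite /tilted_shift /tilted_mean; under eq_integral do rewrite mul1e; exact: th_mean.
Qed.

Lemma crossing_level_le j (v : R) (N : nat) : 0 <= v ->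
  (\sum_(k < N) \int[P]_(w in crosses S (2 ^- j) v k) (Num.max (S (k%:R * 2 ^- j)%R w) 0)%:E
    <= th^-1%:E)%E.
Proof.
move=> v0.
have m1 : measurable_fun setT (cst (1%E : \bar R) : R * R -> \bar R) by exact: measurable_cst.
have := @sum_crosses_le j (cst 1%E) (cst 1%E) (fun t w => expR (- (th * v)) * (th * Num.max (S t w) 0))
  v N v0 (fun=> lee01) (fun=> lexx _) m1 m1.
move=> H.
have {}H : ((expR (th * v))%:E *
   \sum_(k < N) \int[P]_(w in crosses S (2 ^- j) v k)
     (expR (- (th * v)) * (th * Num.max (S (k%:R * 2 ^- j)%R w) 0))%:E <= 1)%E.
  apply: H => [x|x _|t w|t w Sv].
  - by rewrite tilted_shift1.
  - by rewrite tilted_shift1.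
  - by rewrite !mulr_ge0 ?expR_ge0 ?(ltW th0)// le_max lexx orbT.
  - rewrite mul1e lee_fin mulrA -expRD subrr expR0 mul1r max_l ?(le_trans v0 (ltW Sv))//.
    by apply: le_trans (expR_ge1Dx _); rewrite lerDr.
rewrite -[leRHS]mule1 lee_pdivlMl//; apply: le_trans H.
rewrite !ge0_sume_distrr; last 2 first.
- by move=> k _; apply: integral_ge0 => w _; rewrite lee_fin !mulr_ge0 ?expR_ge0 ?(ltW th0)// le_max lexx orbT.
- by move=> k _; apply: integral_ge0 => w _; rewrite lee_fin le_max lexx orbT.
apply: lee_sum => k _.
rewrite [in leLHS]integral_mkcond [in leRHS]integral_mkcond -!ge0_integralZl_lower ?expR_ge0 ?(ltW th0)//; last 2 first.
- by move=> w; apply: erestrict_ge0 => ? _; rewrite lee_fin !mulr_ge0 ?expR_ge0 ?(ltW th0)// le_max lexx orbT.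
- by move=> w; apply: erestrict_ge0 => ? _; rewrite lee_fin le_max lexx orbT.
rewrite le_eqVlt; apply/orP; left; apply/eqP; apply: eq_integral => w _.
rewrite /patch; case: ifPn => _; last by rewrite !mule0.
rewrite -!EFinM; congr (_%:E).
by rewrite [RHS](mulrA (expR _)) -expRD subrr expR0 mul1r.
Qed.

Hypotheses (iS : P.-integrable setT (EFin \o (S 1 \* weight 1)))
  (mS_gt0 : 0 < \int[P]_w (S 1 w * expR (th * S 1 w)))
  (Zcentered : tilted_centered P S Z th 1).

Let m1 : measurable_fun setT (S 1). Proof. exact: planar_measurable1 L _ ler01. Qed.
Let m2 : measurable_fun setT (Z 1). Proof. exact: planar_measurable2 L _ ler01. Qed.

Let tshiftE t (g : R * R -> R) x :
  tshift t (EFin \o g) x =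
  (\int[P]_w (g (x.1 + S t w, x.2 + Z t w)%R * expR (th * S t w))%:E)%E.
Proof. by rewrite /tilted_shift /tilted_mean; apply: eq_integral => w _; rewrite EFinM. Qed.

Let measurable_smooth_abs L0 : measurable_fun setT (fun x : R * R => smooth_abs L0 x.2).
Proof.
apply: (measurableT_comp (continuous_measurable_fun (@sqrt_continuous R))).
by apply: measurable_funD => //; apply: measurable_funX; exact: measurable_snd.
Qed.

Let measurable_below (c : R) : measurable_fun setT (fun x : R * R => Num.max (c - x.1) 0).
Proof. by apply: measurable_maxr => //; exact: measurable_funB. Qed.

Lemma crossing_norm_le (e : R) : 0 < e ->
  exists2 C, 0 <= C & forall j (v : R) N, 0 <= v ->
  (\sum_(k < N) \int[P]_(w in crosses S (2 ^- j) v k) `|Z (k%:R * 2 ^- j)%R w|%:E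
    <= (expR (- (th * v)) * (C + e * v))%:E)%E.
Proof.
move=> e0; have [iZ Z0] := Zcentered.
have [L0 [K [L0_gt0 K0 H]]] := smooth_abs_potential m1 m2 (mw ler01)
  (fun w => expR_ge0 _) (th_mean ler01) iS iZ e0 Z0 mS_gt0.
exists (L0 + e * K); first by rewrite addr_ge0 ?mulr_ge0// ltW.
move=> j v N v0.
pose g : R * R -> \bar R := EFin \o (fun x => smooth_abs L0 x.2).
pose G : R * R -> \bar R := EFin \o (fun x => smooth_abs L0 x.2 + e * Num.max (v + K - x.1) 0).
have [iZj Zj0] := tilted_centered_dyadic L th_mean j Zcentered.
have HH : ((expR (th * v))%:E * \sum_(k < N) \int[P]_(w in crosses S (2 ^- j) v k)
    `|Z (k%:R * 2 ^- j)%R w|%:E <= G (0, 0)%R)%E.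
  apply: (@sum_crosses_le j g G (fun t w => `|Z t w|)) => //.
  - by move=> x; rewrite lee_fin smooth_abs_ge0.
  - by move=> x; rewrite lee_fin lerDl mulr_ge0 ?(ltW e0)// le_max lexx orbT.
  - exact/measurable_EFinP.
  - by apply/measurable_EFinP; apply: measurable_funD => //; exact: measurable_funM.
  - move=> x; rewrite tshiftE /=.
    apply: (smooth_abs_jensen (planar_measurable2 L (dyadic0 j)) (mw (dyadic0 j)) _
      (th_mean (dyadic0 j)) iZj _ L0_gt0 Zj0) => w; exact: expR_ge0.
  - by move=> x xv; rewrite tshiftE; exact: H.
  - move=> t w Sv; rewrite /g /= -EFinM lee_fin mulrC ler_pM ?expR_ge0//.
      exact: norm_le_smooth_abs.
    by rewrite ler_expR ler_wpM2l ?(ltW th0)// ltW.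
rewrite expRN EFinM lee_pdivlMl ?expR_gt0//; apply: (le_trans HH).
rewrite /G /= smooth_abs0 ?(ltW L0_gt0)// subr0 max_l ?addr_ge0 ?(ltW K0)// lee_fin.
by rewrite mulrDr; lra.
Qed.

End crossing_bounds.

(** * Lower bound for the crossing probability *)

Definition above {R : realType} (c : R) (x : R * R) : R := (c < x.1)%R%:R.

Lemma measurable_above {R : realType} (c : R) : measurable_fun setT (above c).
Proof.
have -> : above c = \1_(fst @^-1` `]c, +oo[%classic : set (R * R)).
  apply/funext => x; rewrite indicE; congr ((nat_of_bool _)%:R).
  by apply/idP/idP; rewrite inE /= in_itv/= andbT.
by apply: measurable_indic; rewrite -[X in measurable X]setTI; exact: measurable_fst.
Qed.

#[local] Hint Extern 0 (measurable_fun _ (above _)) => solve [exact: measurable_above] : core.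

Section crossing_probability.
Context {dp : measure_display} {T : measurableType dp} {R : realType}.
Variables (P : probability T R) (S Z : R -> T -> R) (th : R).
Hypothesis L : planar_levy P S Z.
Hypothesis th0 : 0 < th.
Hypothesis th_mean : forall t, 0 <= t -> (\int[P]_w (expR (th * S t w))%:E = 1)%E.
Local Notation tmean := (tilted_mean P S Z th).
Local Notation tshift := (tilted_shift P S Z th).
Local Notation weight t := (fun w => expR (th * S t w)).
Hypotheses (iS : P.-integrable setT (EFin \o (S 1 \* weight 1)))
  (mS_gt0 : 0 < \int[P]_w (S 1 w * expR (th * S 1 w))).

Let m := \int[P]_w (S 1 w * expR (th * S 1 w)).
Let time (p : nat) : R := p%:R * 1.
Let time0 p : 0 <= time p. Proof. by rewrite mulr_ge0. Qed.
Let timeS p : time p + 1 = time p.+1. Proof. by rewrite /time -natr1 mulrDl mul1r. Qed.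

Let mw t : 0 <= t -> measurable_fun setT (weight t).
Proof.
move=> t0; apply: (measurableT_comp (@measurable_expR R)).
by apply: measurable_funM => //; exact: planar_measurable1 L _ t0.
Qed.

Let m1 : measurable_fun setT (S 1). Proof. exact: planar_measurable1 L _ ler01. Qed.

Let mstays v k : measurable (stays S 1 v k).
Proof.
case: k => [|k]; first by rewrite stays0.
by apply: (grid_past_measurable L ler01 (k := k)); exact: (grid_past_stays L).
Qed.

Let mcrosses v k : measurable (crosses S 1 v k).
Proof. by apply: (grid_past_measurable L ler01 (k := k)); exact: (grid_past_crosses L). Qed.

Lemma superharmonic_killed_sum (g d : R * R -> \bar R) (v : R) (n : nat) :
  (forall x, 0 <= g x)%E -> (forall x, 0 <= d x)%E ->
  measurable_fun setT g -> measurable_fun setT d ->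
  (forall x, x.1 <= v -> (tshift 1 g x + d x <= g x)%E) ->
  (\sum_(p < n) tmean (time p) (stays S 1 v p.+1) d <= g (0, 0)%R)%E.
Proof.
move=> g0 d0 mg md gd.
have r1 : 1%:R * 1 = 1 :> R by rewrite mulr1.
have := superharmonic_sum L ler01 r1 n g0 d0 mg md gd.
apply: le_trans; apply: (@le_trans _ _ (\sum_(p < n)
   (tmean ((p.+1 * 1)%:R * 1)%R (stays S 1 v (p * 1).+1 `\` stays S 1 v (p.+1 * 1).+1) g
                 + tmean ((p * 1)%:R * 1)%R (stays S 1 v (p * 1).+1) d))%E).
  by apply: lee_sum => p _; rewrite !muln1 leeDr// tilted_mean_ge0.
by rewrite leeDl// tilted_mean_ge0.
Qed.

Let one : R * R -> \bar R := cst 1%E.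
Let m_one : measurable_fun setT one. Proof. exact: measurable_cst. Qed.
Let one_ge0 x : (0 <= one x)%E. Proof. exact: lee01. Qed.

Let alive v p := tmean (time p) (stays S 1 v p.+1) one.

Let aliveS v p : tmean (time p.+1) (stays S 1 v p.+1) one = alive v p.
Proof.
rewrite -timeS (tilted_markov th L)//; last exact: (grid_past_stays L).
congr (tmean _ _ _); apply/funext => x; exact: tilted_shift1.
Qed.

Let alive_ge0 v p : (0 <= alive v p)%E. Proof. exact: tilted_mean_ge0. Qed.

Let total_mass v n :
  (\sum_(k < n.+1) tmean (time k) (crosses S 1 v k) one + alive v n = 1)%E.
Proof.
elim: n => [|n IH].
  rewrite big_ord_recl big_ord0 adde0 /alive addeC -(tilted_meanU th L)//; last first.
    exact: staysS_crosses_disj.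
  rewrite -staysS_crosses stays0 /tilted_mean.
  by under eq_integral do rewrite mul1e; exact: th_mean.
rewrite big_ord_recr /= -addeA -[RHS]IH; congr (_ + _)%E.
rewrite -[alive v n]aliveS [in RHS]staysS_crosses addeC -(tilted_meanU th L)//.
exact: staysS_crosses_disj.
Qed.

Let alive_decr v p q : (p <= q)%N -> (alive v q <= alive v p)%E.
Proof.
move=> /subnKC <-; elim: (q - p)%N => [|i IH]; first by rewrite addn0.
rewrite addnS; apply: le_trans IH; rewrite -[leRHS]aliveS /alive /tilted_mean.
apply: ge0_subset_integral => //; [ | |exact: sub_stays].
- by apply: measurable_funTS; apply: (measurable_tilted th L).
- by move=> w _; rewrite mule_ge0.
Qed.

Section drift.
Variables (K u : R).
Hypotheses (K0 : 0 <= K) (u0 : 0 <= u).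
Hypothesis HK : m / 2 <= \int[P]_w (Num.min (S 1 w) K * expR (th * S 1 w)).

Let m0 : 0 < m / 2. Proof. by rewrite divr_gt0. Qed.

Let below (x : R * R) : R := (m / 2)^-1 * Num.max (u + K - x.1) 0.

Let below_ge0 x : 0 <= below x.
Proof. by rewrite mulr_ge0 ?invr_ge0 ?(ltW m0)// le_max lexx orbT. Qed.

Let m_below : measurable_fun setT below.
Proof.
by apply: measurable_funM => //; apply: measurable_maxr => //; exact: measurable_funB.
Qed.

Let tshiftE t (g : R * R -> R) x :
  tshift t (EFin \o g) x =
  (\int[P]_w (g (x.1 + S t w, x.2 + Z t w)%R * expR (th * S t w))%:E)%E.
Proof. by rewrite /tilted_shift /tilted_mean; apply: eq_integral => w _; rewrite EFinM. Qed.

Let below_drift x : x.1 <= u -> (tshift 1 (EFin \o below) x + 1 <= (below x)%:E)%E.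
Proof.
move=> xu; have := distance_below_drift m1 (mw ler01) (fun w => expR_ge0 _)
  (th_mean ler01) iS K0 xu.
set I := integral _ _ _ => H.
have I0 : (0 <= I)%E.
  by apply: integral_ge0 => w _; rewrite lee_fin mulr_ge0 ?expR_ge0// le_max lexx orbT.
have -> : tshift 1 (EFin \o below) x = ((m / 2)^-1%:E * I)%E.
  rewrite tshiftE /I -ge0_integralZl_EFin//.
  - by apply: eq_integral => w _; rewrite -EFinM mulrA.
  - by move=> w _; rewrite lee_fin mulr_ge0 ?expR_ge0// le_max lexx orbT.
  - apply/measurable_EFinP; apply: measurable_funM; last exact: mw.
    by apply: measurable_maxr => //; apply: measurable_funB => //; exact: measurable_funD.
  - by rewrite invr_ge0 ltW.
have -> : (1 = (m / 2)^-1%:E * (m / 2)%:E :> \bar R)%E.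
  by rewrite -EFinM mulVf// gt_eqF.
rewrite -ge0_muleDr ?lee_fin ?(ltW m0)// /below (EFinM (m / 2)^-1).
rewrite lee_wpmul2l ?lee_fin ?invr_ge0 ?(ltW m0)//.
by apply: le_trans H; rewrite leeD2l// lee_fin.
Qed.

Let alive_le n : ((n%:R)%:E * alive u n <= ((m / 2)^-1 * (u + K))%:E)%E.
Proof.
have b0 x : (0 <= (EFin \o below) x)%E by rewrite lee_fin.
have mb : measurable_fun setT (EFin \o below) by exact/measurable_EFinP.
have : (\sum_(p < n) alive u p <= (below (0, 0))%:E)%E.
  exact: superharmonic_killed_sum b0 one_ge0 mb m_one below_drift.
rewrite /below /= subr0 max_l ?addr_ge0//; apply: le_trans.
apply: (@le_trans _ _ (\sum_(p < n) alive u n)%E); last first.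
  by apply: lee_sum => p _; apply: alive_decr; exact: ltnW.
move: (alive u n) (alive_ge0 u n) => a a0.
suff -> : (\sum_(p < n) a = (n%:R)%:E * a)%E by [].
elim: n => [|k IHk]; first by rewrite big_ord0 mul0e.
by rewrite big_ord_recr /= IHk -natr1 EFinD ge0_muleDl ?lee_fin// mul1e.
Qed.

Lemma alive_small : exists n, (alive u n <= (4^-1)%:E)%E.
Proof.
set C := (m / 2)^-1 * (u + K).
exists (Num.truncn (4 * C)).+1; set n := _.+1.
have n0 : (0 < n%:R :> R) by rewrite ltr0n.
have Cn : 4 * C <= n%:R by rewrite ltW// truncnS_gt.
rewrite -(@lee_pmul2l _ n%:R%:E)//; apply: le_trans (alive_le n) _.
by rewrite -EFinM lee_fin -/C; lra.
Qed.

(* Expected time that the walk spends in [(u - y, u]] before leaving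
   [(-oo, u]]. *)
Lemma visits_le (y : R) (n : nat) : 0 <= y ->
  (\sum_(p < n) tmean (time p) (stays S 1 u p.+1) (EFin \o above (u - y)%R) <=
   ((m / 2)^-1 * (y + K))%:E)%E.
Proof.
move=> y0; pose g x := Num.min (below x) ((m / 2)^-1 * (y + K)).
have cap0 : 0 <= (m / 2)^-1 * (y + K) by rewrite mulr_ge0 ?invr_ge0 ?(ltW m0)// addr_ge0.
have g0 x : 0 <= g x by rewrite le_min below_ge0.
have mg : measurable_fun setT (EFin \o g).
  by apply/measurable_EFinP; exact: measurable_minr.
have i0 x : (0 <= (EFin \o above (u - y)%R) x)%E by rewrite lee_fin.
have mi : measurable_fun setT (EFin \o above (u - y)%R) by exact/measurable_EFinP.
apply: le_trans (superharmonic_killed_sum (g := EFin \o g) n _ i0 mg mi _) _.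
- by move=> x; rewrite lee_fin.
- move=> x xu; rewrite /= /above.
  have g_below : (tshift 1 (EFin \o g) x <= tshift 1 (EFin \o below) x)%E.
    rewrite !tshiftE; apply: ge0_le_integral_lower => w _.
      by rewrite lee_fin mulr_ge0 ?expR_ge0.
    by rewrite lee_fin ler_wpM2r ?expR_ge0// ge_min lexx.
  have [yx|yx] := ltP (u - y) x.1.
    have -> : g x = below x.
      rewrite /g min_l// /below ler_wpM2l ?invr_ge0 ?(ltW m0)// max_l.
        by rewrite addrAC lerD2r lerBlDr -lerBlDl ltW.
      by rewrite subr_ge0 ler_wpDr.
    by apply: le_trans (below_drift xu); rewrite leeD2r.
  have -> : g x = (m / 2)^-1 * (y + K).
    rewrite /g min_r// /below ler_wpM2l ?invr_ge0 ?(ltW m0)// max_l.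
      by rewrite addrAC lerD2r lerBrDr -lerBrDl.
    by rewrite subr_ge0 ler_wpDr.
  rewrite adde0 tshiftE.
  apply: (@le_trans _ _ (\int[P]_w (((m / 2)^-1 * (y + K))%:E * (expR (th * S 1 w))%:E))%E).
    apply: ge0_le_integral_lower => w _; first by rewrite lee_fin mulr_ge0 ?expR_ge0.
    by rewrite -EFinM lee_fin ler_wpM2r ?expR_ge0// ge_min lexx orbT.
  have mw1 : measurable_fun setT (fun w => (expR (th * S 1 w))%:E).
    by apply/measurable_EFinP; exact: mw.
  by rewrite ge0_integralZl_EFin// (th_mean ler01) mule1.
- by rewrite lee_fin ge_min lexx orbT.
Qed.

Lemma overshoot_le (B : R) n : K <= B ->
  (\sum_(p < n) tmean (time p.+1) (stays S 1 u p.+1) (EFin \o above (u + B)%R) <=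
   \int[P]_w ((m / 2)^-1 * (`|S 1 w| * \1_[set w | (B < S 1 w)%R] w * expR (th * S 1 w)))%:E)%E.
Proof.
move=> KB.
have o0 x : (0 <= (EFin \o above (u + B)%R) x)%E by rewrite lee_fin.
have mo : measurable_fun setT (EFin \o above (u + B)%R) by exact/measurable_EFinP.
pose F p (x : T * T) : \bar R :=
  ((above (u + B)%R (S (time p) x.1 + S 1 x.2, 0) * expR (th * S 1 x.2)) *
   (expR (th * S (time p) x.1) * \1_(stays S 1 u p.+1) x.1))%:E.
have F0 p x : (0 <= F p x)%E by rewrite lee_fin !mulr_ge0 ?expR_ge0.
have mF p : measurable_fun setT (F p).
  apply/measurable_EFinP; apply: measurable_funM; apply: measurable_funM.
  - apply: (measurableT_comp (measurable_above (u + B))); apply/measurable_fun_pair => //=.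
    apply: measurable_funD.
      exact: (measurableT_comp (planar_measurable1 L (time0 p)) measurable_fst).
    exact: (measurableT_comp m1 measurable_snd).
  - exact: (measurableT_comp (mw ler01) measurable_snd).
  - exact: (measurableT_comp (mw (time0 p)) measurable_fst).
  - have mI : measurable_fun setT (\1_(stays S 1 u p.+1) : T -> R) by exact: measurable_indic.
    exact: (measurableT_comp mI measurable_fst).
have E p : tmean (time p.+1) (stays S 1 u p.+1) (EFin \o above (u + B)%R) =
    (\int[P]_w' \int[P]_w F p (w, w'))%E.
  rewrite -timeS (tilted_markov th L)//; last exact: (grid_past_stays L).
  rewrite -/(time p) -(fubini_tonelli (m1 := P) (m2 := P) (F p))//.
  rewrite /tilted_mean integral_mkcond; apply: eq_integral => w _.
  rewrite /fubini_F /F /= patchE indicE.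
  case: (w \in _).
    rewrite tshiftE -ge0_integralZr ?lee_fin ?expR_ge0//.
    - by apply: eq_integral => w' _; rewrite -EFinM mulr1 /above.
    - apply/measurable_EFinP; apply: measurable_funM; last exact: mw.
      apply: (measurableT_comp (measurable_above (u + B))); apply/measurable_fun_pair; apply: measurable_funD => //.
      exact: planar_measurable2 L _ ler01.
    - by move=> w' _; rewrite lee_fin mulr_ge0 ?expR_ge0.
  by under eq_integral do rewrite mulr0n !mulr0; rewrite integral0.
under eq_bigr do rewrite E.
rewrite -ge0_integral_sum//; last 2 first.
- by move=> p; exact: (measurable_fun_fubini_tonelli_G (m1 := P) (F p)).
- by move=> p w' _; apply: integral_ge0.
apply: ge0_le_integral_lower => w' _.
  by apply: sume_ge0 => p _; apply: integral_ge0.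
rewrite indicE; have [SB|SB] := ltP B (S 1 w'); last first.
  rewrite memNset/= ?ltNge ?SB//.
  rewrite mulr0 mul0r mulr0 big1// => p _; apply: integral0_eq => w _; rewrite /F /=.
  rewrite [X in _ * (_ * X)]indicE; have [|_] := boolP (_ \in _); last by rewrite !mulr0.
  rewrite inE => /(_ p (ltnSn p)) Su.
  by rewrite /above ltNge /= lerD// !mul0r.
rewrite mem_set// mulr1.
apply: (@le_trans _ _ (\sum_(p < n) (tmean (time p) (stays S 1 u p.+1)
    (EFin \o above (u - (S 1 w' - B))%R) * (expR (th * S 1 w'))%:E))%E).
  apply: lee_sum => p _.
  rewrite /tilted_mean [in leRHS]integral_mkcond -ge0_integralZr//; last 2 first.
  - apply: (measurable_restrictT _ (mstays u p.+1)).1; apply: measurable_funTS.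
    by apply: (measurable_tilted th L) => //; exact/measurable_EFinP.
  - by move=> w _; apply: erestrict_ge0 => ? _; rewrite mule_ge0 ?lee_fin ?expR_ge0.
  apply: ge0_le_integral_lower => w _ //.
  rewrite /F /= patchE [X in _ * (_ * X)]indicE.
  case: (w \in _); last by rewrite !mulr0 mul0e.
  rewrite mulr1 -!EFinM lee_fin /above /planar /= opprB addrA ltrBlDr.
  by rewrite mulrAC.
rewrite -ge0_sume_distrl; last by move=> p _; apply: tilted_mean_ge0 => x; rewrite lee_fin.
have y0 : 0 <= S 1 w' - B by rewrite subr_ge0 ltW.
apply: (@le_trans _ _ (((m / 2)^-1 * (S 1 w' - B + K))%:E * (expR (th * S 1 w'))%:E)%E).
  by rewrite lee_wpmul2r ?lee_fin ?expR_ge0//; exact: visits_le.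
rewrite -EFinM lee_fin mulrA ler_wpM2r ?expR_ge0// ler_wpM2l ?invr_ge0 ?(ltW m0)//.
by have := ler_norm (S 1 w'); lra.
Qed.

Lemma crossing_mass_le (B : R) p :
  (tmean (time p.+1) (crosses S 1 u p.+1) one <=
   (expR (th * (u + B)))%:E * P (crosses S 1 u p.+1) +
   tmean (time p.+1) (stays S 1 u p.+1) (EFin \o above (u + B)%R))%E.
Proof.
have mo : measurable_fun setT (fun w => (above (u + B)%R (planar S Z (time p.+1) w))%:E).
  apply/measurable_EFinP; apply: (measurableT_comp (measurable_above (u + B))).
  exact: measurable_planar L _ (time0 _).
have me : measurable_fun setT (fun w => (expR (th * S (time p.+1) w))%:E).
  by apply/measurable_EFinP; exact: mw.
apply: (@le_trans _ _ (\int[P]_(w in crosses S 1 u p.+1) ((expR (th * (u + B)))%:E +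
    (above (u + B)%R (planar S Z (time p.+1) w))%:E * (expR (th * S (time p.+1) w))%:E))%E).
  apply: ge0_le_integral_lower => w _; first by rewrite mul1e lee_fin expR_ge0.
  rewrite mul1e /above -EFinM -EFinD lee_fin /=.
  have [_|uB] := ltP; first by rewrite mul1r lerDr expR_ge0.
  by rewrite mul0r addr0 ler_expR ler_wpM2l ?(ltW th0).
rewrite ge0_integralD//; last 2 first.
- by move=> w _; rewrite -EFinM lee_fin mulr_ge0 ?expR_ge0.
- by apply: measurable_funTS; exact: emeasurable_funM.
rewrite integral_cst//; apply: leeD => //.
apply: ge0_subset_integral => //.
- by apply: measurable_funTS; exact: emeasurable_funM.
- by move=> w _; rewrite -EFinM lee_fin mulr_ge0 ?expR_ge0.
- by move=> w [].
Qed.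

End drift.

Lemma crossing_probability_ge : exists2 c : R, 0 < c & forall u : R, 0 <= u ->
  exists N, ((c * expR (- (th * u)))%:E <= \sum_(k < N) P (crosses S 1 u k))%E.
Proof.
have W0 w : 0 <= weight 1 w by exact: expR_ge0.
have m20 : 0 < m / 2 by rewrite divr_gt0.
have m80 : 0 < m / 8 by rewrite divr_gt0.
have [K K0 HK'] := truncated_mean_near m1 (mw ler01) W0 iS m20.
have HK : m / 2 <= \int[P]_w (Num.min (S 1 w) K * expR (th * S 1 w)).
  by apply: le_trans HK'; rewrite lerBrDr -splitr.
have [B KB HB] := tail_mean_small m1 (mw ler01) W0 iS K m80.
exists (expR (- (th * B)) / 2) => [|u u0]; first by rewrite divr_gt0 ?expR_gt0.
have [n Hn] := alive_small (ltW K0) u0 HK.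
exists n.+1; have := total_mass u n.
rewrite !big_ord_recl (crosses0 L)// measure0 add0e.
rewrite {1}/tilted_mean integral_set0 add0e => mass.
set E : R := expR (th * (u + B)).
set M := (\sum_(i < n) P _)%E.
have M0 : (0 <= M)%E by apply: sume_ge0.
have over4 : (\sum_(p < n) tmean (time p.+1) (stays S 1 u p.+1)
    (EFin \o above (u + B)%R) <= (4^-1)%:E)%E.
  apply: le_trans (overshoot_le u (ltW K0) HK n KB) _.
  under eq_integral do rewrite EFinM.
  rewrite ge0_integralZl_EFin//; last 2 first.
  - apply/measurable_EFinP; apply: measurable_funM; last exact: mw.
    apply: measurable_funM.
      exact: (measurableT_comp (@normr_measurable R setT)).
    apply: measurable_indic; rewrite -[X in measurable X]setTI.
    have -> : [set w | B < S 1 w] = S 1 @^-1` `]B, +oo[%classic.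
      by apply/seteqP; split => x /=; rewrite in_itv/= andbT.
    exact: m1.
  - by rewrite invr_ge0 ltW.
  apply: (@le_trans _ _ ((m / 2)^-1%:E * (m / 8)%:E)%E).
    by rewrite lee_wpmul2l// lee_fin invr_ge0 ltW.
  rewrite -EFinM lee_fin.
  have mN0 : m != 0 by rewrite gt_eqF.
  have -> : (m / 2)^-1 * (m / 8) = 4^-1 by field.
  exact: lexx.
have H1 : (1 <= E%:E * M + (2^-1)%:E)%E.
  rewrite -mass; apply: (@le_trans _ _ (\sum_(p < n) (E%:E * P (crosses S 1 u p.+1) +
     tmean (time p.+1) (stays S 1 u p.+1)
    (EFin \o above (u + B)%R)) + (4^-1)%:E)%E).
    apply: leeD => //; apply: lee_sum => p _; rewrite lift0; exact: crossing_mass_le.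
  rewrite big_split /= -ge0_sume_distrr// -addeA; apply: leeD.
    by rewrite lee_wpmul2l ?lee_fin ?expR_ge0// /M; apply: lee_sum => p _; rewrite lift0.
  apply: (@le_trans _ _ ((4^-1)%:E + (4^-1)%:E)%E); first exact: leeD.
  by rewrite -EFinD lee_fin; lra.
have EE : (2^-1 : R)%:E = (E * (expR (- (th * B)) / 2 * expR (- (th * u))))%:E.
  congr (_%:E); rewrite /E mulrDr expRD !expRN.
  have := expR_gt0 (th * B); have := expR_gt0 (th * u) => /gt_eqF/negbT a0 /gt_eqF/negbT b0.
  by field; apply/andP.
have E0 : 0 < E by exact: expR_gt0.
rewrite -(@lee_pmul2l _ E%:E)// -EFinM -EE.
have EM0 : (0 <= E%:E * M)%E by rewrite mule_ge0// lee_fin ltW.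
move: H1 EM0; case: (E%:E * M)%E => [x| |] //; last by move=> _ _; rewrite leey.
by rewrite -EFinD !lee_fin => *; lra.
Qed.

End crossing_probability.

(** * First passages of cadlag paths *)

Section cadlag_paths.
Context {R : realType}.
Implicit Types (y : R -> R) (a l : R).

Definition near_right y a : Prop :=
  forall e, 0 < e -> exists2 d, 0 < d & forall t, a <= t -> t < a + d -> `|y t - y a| < e.

Definition near_left y a l : Prop :=
  forall e, 0 < e -> exists2 d, 0 < d & forall t, a - d < t -> t < a -> `|y t - l| < e.

Lemma cadlag_near_right y a : cadlag y -> 0 <= a -> near_right y a.
Proof.
move=> [+ _] a0 e e0; move=> /(_ a a0) /cvgrPdist_lt /(_ e e0).
move=> -[d /= d0 H]; exists d => // t.
rewrite le_eqVlt => /predU1P[<-|at_] td; first by rewrite subrr normr0.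
rewrite distrC; apply: H => //=.
by rewrite /ball/= distrC ger0_norm ?subr_ge0 ?ltW// ltrBlDl.
Qed.

Lemma cadlag_near_left y a : cadlag y -> 0 < a -> exists l, near_left y a l.
Proof.
move=> [_ +] a0; move=> /(_ a a0) /cvg_ex[l H]; exists l => e e0.
move: H => /cvgrPdist_lt /(_ e e0) -[d /= d0 H].
exists d => // t tl ta; rewrite distrC; apply: H => //=.
by rewrite /ball/= ger0_norm ?subr_ge0 ?ltW// ltrBlDl -ltrBlDr.
Qed.

Lemma near_right_seq y a (x : nat -> R) : near_right y a ->
  (forall n, a <= x n) -> x n @[n --> \oo] --> a -> y (x n) @[n --> \oo] --> y a.
Proof.
move=> ya ax xa; apply/cvgrPdist_lt => e e0; have [d d0 H] := ya e e0.
move/cvgrPdist_lt : xa => /(_ d d0); apply: filterS => n Hn.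
rewrite distrC; apply: H => //; move: Hn.
by rewrite distrC ger0_norm ?subr_ge0// ltrBlDl.
Qed.

Lemma near_left_seq y a l (x : nat -> R) : near_left y a l ->
  (forall n, x n < a) -> x n @[n --> \oo] --> a -> y (x n) @[n --> \oo] --> l.
Proof.
move=> ya ax xa; apply/cvgrPdist_lt => e e0; have [d d0 H] := ya e e0.
move/cvgrPdist_lt : xa => /(_ d d0); apply: filterS => n Hn.
rewrite distrC; apply: H => //; move: Hn.
by rewrite ger0_norm ?subr_ge0 ?ltW// ltrBlDl -ltrBlDr.
Qed.

Lemma near_left_right y a (x l : nat -> R) : near_right y a ->
  (forall n, a < x n) -> x n @[n --> \oo] --> a ->
  (forall n, near_left y (x n) (l n)) -> l n @[n --> \oo] --> y a.
Proof.
move=> ya ax xa xl; apply/cvgrPdist_lt => e e0.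
have e2 : 0 < e / 2 by rewrite divr_gt0.
have [d d0 H] := ya _ e2.
move/cvgrPdist_lt : xa => /(_ d d0); apply: filterS => n.
rewrite distrC ger0_norm ?subr_ge0 ?(ltW (ax n))// ltrBlDl => xd.
have [d' d'0 H'] := xl n _ e2.
pose t := Num.max ((a + x n) / 2) (x n - d' / 2).
have tx : t < x n.
  rewrite gt_max; apply/andP; split; first by have := ax n; lra.
  by rewrite ltrBlDr ltrDl divr_gt0.
have at_ : a <= t by rewrite le_max; apply/orP; left; have := ax n; lra.
have dt : x n - d' < t by rewrite lt_max; apply/orP; right; lra.
have h1 := H t at_ (lt_trans tx xd); have h2 := H' t dt tx.
rewrite (le_lt_trans (ler_distD (y t) _ _))// [e]splitr ltrD// distrC//.
Qed.

(* [passage s v] is the first passage time of the path [s] strictly above [v]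
   (junk if [s] never exceeds [v]). *)
Definition passage (s : R -> R) (v : R) : R := inf [set t | 0 <= t /\ v < s t].

Section passage.
Variables (s : R -> R) (v : R).
Hypothesis s_cadlag : cadlag s.
Hypothesis s_above : exists t, 0 <= t /\ v < s t.

Let has_inf_above : has_inf [set t | 0 <= t /\ v < s t].
Proof. by split; [exact: s_above|exists 0 => t []]. Qed.

Lemma passage_ge0 : 0 <= passage s v.
Proof. by apply: lb_le_inf; [exact: s_above|move=> t []]. Qed.

Lemma passage_le t : 0 <= t -> v < s t -> passage s v <= t.
Proof. by move=> t0 vt; apply: ge_inf; [exact: has_inf_above.2|]. Qed.

Lemma le_passage : v <= s (passage s v).
Proof.
rewrite leNgt; apply/negP => sv.
have gap : 0 < v - s (passage s v) by rewrite subr_gt0.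
have [d d0 H] := cadlag_near_right s_cadlag passage_ge0 gap.
have [t [t0 vt] td] := inf_adherent d0 has_inf_above.
have := H t (passage_le t0 vt) td; rewrite ltr_norml => /andP[_]; lra.
Qed.

Lemma grid_passage (e : R) : 0 < e -> \forall j \near \oo, exists k : nat,
  [/\ v < s (k%:R * 2 ^- j), (forall i : nat, (i < k)%N -> s (i%:R * 2 ^- j) <= v),
      passage s v <= k%:R * 2 ^- j & k%:R * 2 ^- j < passage s v + e].
Proof.
move=> e0; have e2 : 0 < e / 2 by rewrite divr_gt0.
have [t [t0 vt] td] := inf_adherent e2 has_inf_above.
have gap : 0 < s t - v by rewrite subr_gt0.
have [d d0 H] := cadlag_near_right s_cadlag t0 gap.
pose c := Num.min d (e / 2).
have c0 : 0 < c by rewrite lt_min d0.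
have := @cvg_expr R 2^-1; rewrite ger0_norm ?invr_ge0//.
have half1 : 2^-1 < 1 :> R by rewrite invf_lt1// ltr1n.
move=> /(_ half1) /cvgrPdist_lt /(_ c c0); apply: filterS => j.
rewrite sub0r normrN exprVn ger0_norm ?invr_ge0 ?exprn_ge0// => jc.
have h0 : 0 < 2 ^- j :> R by rewrite invr_gt0 exprn_gt0.
pose q := (Num.truncn (t / 2 ^- j)).+1.
have tq : t < q%:R * 2 ^- j by rewrite -ltr_pdivrMr// truncnS_gt.
have qt : q%:R * 2 ^- j <= t + 2 ^- j.
  rewrite /q -natr1 mulrDl mul1r lerD2r -ler_pdivlMr//.
  by rewrite truncn_le// divr_ge0// ltW.
have vq : v < s (q%:R * 2 ^- j).
  have := H (q%:R * 2 ^- j) (ltW tq); rewrite (le_lt_trans qt); last first.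
    by rewrite ltrD2l (lt_le_trans jc)// ge_min lexx.
  by move=> /(_ isT); rewrite ltr_norml => /andP[]; lra.
have ex : exists k, v < s (k%:R * 2 ^- j) by exists q.
case: (ex_minnP ex) => k vk kmin; exists k; split => //.
- by move=> i ik; rewrite leNgt; apply/negP => /kmin; rewrite leqNgt ik.
- by apply: passage_le => //; rewrite mulr_ge0// ltW.
- have kq : k%:R * 2 ^- j <= q%:R * 2 ^- j :> R by rewrite ler_wpM2r ?(ltW h0)// ler_nat kmin.
  have : 2 ^- j < e / 2 by rewrite (lt_le_trans jc)// ge_min lexx orbT.
  move: td kq qt; rewrite -/(passage s v); lra.
Qed.

End passage.

End cadlag_paths.

Section bounded_mean.
Context {dp : measure_display} {T : measurableType dp} {R : realType}.
Variable mu : {measure set T -> \bar R}.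
Local Open Scope ereal_scope.
Implicit Types (f : T -> \bar R) (C : \bar R).

Definition bounded_mean f C : Prop :=
  [/\ measurable_fun setT f, forall w, 0 <= f w & \int[mu]_w f w <= C].

Lemma limn_einf_ge0 (u : nat -> \bar R) : (forall n, 0 <= u n) -> 0 <= limn_einf u.
Proof.
move=> u0; rewrite limn_einf_lim; apply: lime_ge; first exact: is_cvg_einfs.
by apply: nearW => n; apply: le_ereal_inf_tmp => _ [m /= _ <-].
Qed.

Lemma limn_einf_le_cst (u : nat -> \bar R) C : (forall n, u n <= C) -> limn_einf u <= C.
Proof.
move=> uC; rewrite limn_einf_lim; apply: lime_le; first exact: is_cvg_einfs.
apply: nearW => n; apply: le_trans (uC n).
by apply: ereal_inf_lbound; exists n => /=.
Qed.

Lemma measurable_limn_einf (f_ : nat -> T -> \bar R) :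
  (forall n, measurable_fun setT (f_ n)) ->
  measurable_fun setT (fun w => limn_einf (f_ ^~ w)).
Proof.
move=> mf; rewrite /limn_einf; apply: (measurableT_comp (@oppe_measurable R setT)).
by apply: measurable_fun_limn_esup => n; exact: (measurableT_comp (@oppe_measurable R setT)).
Qed.

Lemma bounded_mean_limn_einf (f_ : nat -> T -> \bar R) C :
  (forall n, bounded_mean (f_ n) C) ->
  bounded_mean (fun w => limn_einf (f_ ^~ w)) C.
Proof.
move=> H; have mf n := (let: And3 m _ _ := H n in m).
have f0 n w := (let: And3 _ p _ := H n in p w).
have fC n := (let: And3 _ _ c := H n in c); split.
- exact: measurable_limn_einf.
- by move=> w; apply: limn_einf_ge0.
- by apply: le_trans (fatou _ _ _ _) _ => //; apply: limn_einf_le_cst.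
Qed.

End bounded_mean.

Section grid_values.
Context {dp : measure_display} {T : measurableType dp} {R : realType}.
Variables (P : probability T R) (S Z : R -> T -> R).
Hypothesis L : planar_levy P S Z.

Let dyadic0 j : 0 <= 2 ^- j :> R. Proof. by rewrite invr_ge0 exprn_ge0. Qed.

Let mcrosses j v k : measurable (crosses S (2 ^- j) v k).
Proof.
by apply: (grid_past_measurable L (dyadic0 j) (k := k)); exact: (grid_past_crosses L).
Qed.

Lemma crosses_trivIset h v : trivIset setT (fun k => crosses S h v k).
Proof.
apply/trivIsetP => a b _ _ ab; rewrite -subset0 => w [[sa /= va] [sb /= vb]].
have [ltab|ltba|eqab] := ltngtP a b.
- by have := sb a ltab; rewrite leNgt va.
- by have := sa b ltba; rewrite leNgt vb.
- by move: ab; rewrite eqab eqxx.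
Qed.

(* Value of [F] at the first passage above [v] along the grid of mesh [2^-j],
   and [0] if there is no passage. *)
Definition grid_value (F : R -> T -> R) (v : R) (j : nat) (w : T) : \bar R :=
  (\sum_(k <oo) ((F (k%:R * 2 ^- j)%R w)%:E * (\1_(crosses S (2 ^- j) v k) w)%:E))%E.

Lemma grid_value_crosses F v j w k : crosses S (2 ^- j) v k w ->
  grid_value F v j w = (F (k%:R * 2 ^- j) w)%:E.
Proof.
move=> cw; apply/cvg_lim => //; apply: cvg_near_cst; near=> n.
have kn : (k < n)%N by near: n; exact: nbhs_infty_gt.
rewrite big_mkord (bigD1 (Ordinal kn))//= big1 ?adde0.
  by rewrite indicE mem_set// mule1.
move=> i ik; rewrite indicE memNset ?mule0// => -[si /= vi].
have [sk /= vk] := cw.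
have [ltik|ltki|eqik] := ltngtP i k.
- by have := sk i ltik; rewrite leNgt vi.
- by have := si k ltki; rewrite leNgt vk.
- by move: ik; rewrite -val_eqE/= eqik eqxx.
Unshelve. all: by end_near. Qed.

Lemma bounded_mean_grid_value (F : R -> T -> R) v j (C : \bar R) :
  (forall t w, 0 <= F t w) -> (forall t, 0 <= t -> measurable_fun setT (F t)) ->
  (forall N, \sum_(k < N) \int[P]_(w in crosses S (2 ^- j) v k) (F (k%:R * 2 ^- j)%R w)%:E <= C)%E ->
  bounded_mean P (grid_value F v j) C.
Proof.
move=> F0 mF HC.
have t0 k : 0 <= k%:R * 2 ^- j :> R by rewrite mulr_ge0.
have f0 k w : (0 <= (F (k%:R * 2 ^- j)%R w)%:E * (\1_(crosses S (2 ^- j) v k) w)%:E)%E.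
  by rewrite mule_ge0// lee_fin.
have mf k : measurable_fun setT
    (fun w => (F (k%:R * 2 ^- j)%R w)%:E * (\1_(crosses S (2 ^- j) v k) w)%:E)%E.
  apply: emeasurable_funM; apply/measurable_EFinP; first exact: mF.
  exact: measurable_indic.
split.
- by apply: ge0_emeasurable_sum => // k w _ _.
- by move=> w; apply: nneseries_ge0.
- rewrite integral_nneseries//; apply: lime_le.
    by apply: is_cvg_nneseries => k _ _; apply: integral_ge0.
  apply: nearW => N; rewrite big_mkord; apply: le_trans (HC N).
  apply: lee_sum => k _; rewrite [leRHS]integral_mkcond.
  by rewrite epatch_indic.
Qed.

Lemma crosses_probability_le1 j v N :
  (\sum_(k < N) P (crosses S (2 ^- j) v k) <= 1)%E.
Proof.
rewrite -(measure_bigsetU P (F := fun k => crosses S (2 ^- j) v k))//; last first.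
  exact: crosses_trivIset.
by apply: probability_le1; apply: bigsetU_measurable => k _; exact: mcrosses.
Qed.

Lemma crossing_increment_le (f : R * R -> R) (dl v : R) j N :
  0 <= dl -> (forall x, 0 <= f x) -> measurable_fun setT f ->
  (\sum_(k < N) \int[P]_(w in crosses S (2 ^- j) v k)
     (f (planar_step S Z (k%:R * 2 ^- j)%R (k%:R * 2 ^- j + dl)%R w))%:E
   <= \int[P]_w (f (planar S Z dl w))%:E)%E.
Proof.
move=> dl0 f0 mf.
have I0 : (0 <= \int[P]_w (f (planar S Z dl w))%:E)%E.
  by apply: integral_ge0 => w _; rewrite lee_fin.
apply: (@le_trans _ _ (\sum_(k < N) (\int[P]_w (f (planar S Z dl w))%:E *
    P (crosses S (2 ^- j) v k)))%E).
  apply: lee_sum => k _.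
  have pc : grid_past S Z (2 ^- j) k (crosses S (2 ^- j) v k) by exact: (grid_past_crosses L).
  have := @markov_step _ _ _ P S Z L (2 ^- j) dl k (crosses S (2 ^- j) v k)
    (fun x => (f x.2)%:E) (dyadic0 j) dl0 pc.
  rewrite /= => -> //; last first.
    by apply/measurable_EFinP; exact: (measurableT_comp mf measurable_snd).
    by move=> x; rewrite lee_fin.
  rewrite le_eqVlt; apply/orP; left; apply/eqP.
  exact: (integral_cst P (mcrosses j v k) (\int[P]_w (f (planar S Z dl w))%:E)%E).
rewrite -ge0_sume_distrr// -[leRHS]mule1 lee_wpmul2l//.
exact: crosses_probability_le1.
Qed.

End grid_values.

(** * Absence of jumps at first passages *)

Section nonexpansive.
Context {R : realType}.
Implicit Types f : R -> R.

Definition nonexpansive f : Prop := forall a b, `|f a - f b| <= `|a - b|.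

Lemma nonexpansive_cvg f (x : nat -> R) l : nonexpansive f ->
  x n @[n --> \oo] --> l -> f (x n) @[n --> \oo] --> f l.
Proof.
move=> lf /cvgrPdist_lt xl; apply/cvgrPdist_lt => e /xl.
by apply: filterS => n; exact: le_lt_trans.
Qed.

Lemma nonexpansive_near_right f (y : R -> R) (a : R) : nonexpansive f -> near_right y a ->
  near_right (f \o y) a.
Proof.
move=> lf ya e /ya[d d0 H]; exists d => // t at_ td.
by apply: le_lt_trans (lf _ _) _; exact: H.
Qed.

Definition capped (x : R) : R := Num.min `|x| 1.

Lemma capped_ge0 x : 0 <= capped x. Proof. by rewrite le_min normr_ge0 ler01. Qed.

Lemma capped_le1 x : `|capped x| <= 1.
Proof. by rewrite ger0_norm ?capped_ge0// ge_min lexx orbT. Qed.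

Lemma capped_eq0 x : capped x = 0 -> x = 0.
Proof.
move=> H; apply/normr0_eq0; move: H; rewrite /capped /Num.min.
by case: ifPn => // _ /eqP; rewrite oner_eq0.
Qed.

Lemma nonexpansive_norm : nonexpansive (fun x => `|x|).
Proof. by move=> a b; exact: ler_dist_dist. Qed.

Lemma nonexpansive_capped : nonexpansive capped.
Proof.
move=> a b; apply: le_trans (ler_dist_dist a b).
rewrite /capped; move: `|a| `|b| => {}a {}b; rewrite /Num.min.
by case: ltP => ?; case: ltP => ?; case: (ler0P (a - b)) => ?;
  rewrite ?ler_norml; (try (apply/andP; split)); lra.
Qed.

Lemma pos_ge0 (x : R) : 0 <= Num.max x 0.
Proof. by rewrite le_max lexx orbT. Qed.

Lemma nonexpansive_pos : nonexpansive (fun x => Num.max x 0).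
Proof.
move=> a b; rewrite /Num.max.
by case: ltP => ?; case: ltP => ?; case: (ler0P (a - b)) => ?;
  rewrite ?ler_norml; (try (apply/andP; split)); lra.
Qed.

Lemma measurable_pos : measurable_fun setT (fun x : R => Num.max x 0).
Proof. by apply: measurable_maxr => //; exact: measurable_id. Qed.

Lemma near_right_increment (y : R -> R) (a dl : R) : near_right y a -> near_right y (a + dl) ->
  near_right (fun t => y (t + dl) - y t) a.
Proof.
move=> ya yd e e0; have e2 : 0 < e / 2 by rewrite divr_gt0.
have [d1 d10 H1] := ya _ e2; have [d2 d20 H2] := yd _ e2.
exists (Num.min d1 d2) => [|t at_]; first by rewrite lt_min d10.
rewrite -ltrBlDl lt_min !ltrBlDl => /andP[t1 t2].
have -> : y (t + dl) - y t - (y (a + dl) - y a) =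
  (y (t + dl) - y (a + dl)) - (y t - y a) by ring.
rewrite (le_lt_trans (ler_normB _ _))// [e]splitr ltrD ?H1// H2 ?lerD2r//.
by rewrite addrAC ltrD2r.
Qed.

End nonexpansive.

Section levels.
Context {R : realType}.
Variables (s : R -> R) (u : R).
Hypothesis s_cadlag : cadlag s.
Hypothesis s_reaches : exists t, 0 <= t /\ u <= s t.

Definition level (k : nat) : R := u - k.+1%:R^-1.

Lemma level_lt k : level k < u.
Proof. by rewrite ltrBlDr ltrDl invr_gt0. Qed.

Lemma level_ge k : u - 1 <= level k.
Proof. by rewrite lerD2l lerN2 invf_le1// ler1n. Qed.

Lemma level_le j k : (j <= k)%N -> level j <= level k.
Proof. by move=> jk; rewrite lerD2l lerN2 lef_pV2 ?posrE// ler_nat. Qed.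

Lemma level_reached k : exists t, 0 <= t /\ level k < s t.
Proof.
by case: s_reaches => t [t0 ut]; exists t; split => //; exact: lt_le_trans (level_lt k) ut.
Qed.

Definition hitting : R := inf [set t | 0 <= t /\ u <= s t].

Let has_inf_hit : has_inf [set t | 0 <= t /\ u <= s t].
Proof. by split; [exact: s_reaches|exists 0 => t []]. Qed.

Lemma hitting_ge0 : 0 <= hitting.
Proof. by apply: lb_le_inf; [exact: s_reaches|move=> t []]. Qed.

Lemma hitting_le t : 0 <= t -> u <= s t -> hitting <= t.
Proof. by move=> t0 ut; apply: ge_inf; [exact: has_inf_hit.2|]. Qed.

Lemma le_hitting : u <= s hitting.
Proof.
rewrite leNgt; apply/negP => sv.
have gap : 0 < u - s hitting by rewrite subr_gt0.
have [d d0 H] := cadlag_near_right s_cadlag hitting_ge0 gap.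
have [t [t0 vt] td] := inf_adherent d0 has_inf_hit.
have := H t (hitting_le t0 vt) td; rewrite ltr_norml => /andP[_]; lra.
Qed.

Let sigma k : R := passage s (level k).

Let sigma_le_hitting k : sigma k <= hitting.
Proof.
apply: (passage_le (level_reached k)); first exact: hitting_ge0.
exact: lt_le_trans (level_lt k) le_hitting.
Qed.

Let sigma_nd : nondecreasing_seq sigma.
Proof.
move=> j k jk; apply: lb_le_inf; first exact: level_reached.
move=> t [t0 lt]; apply: (passage_le (level_reached j)) => //.
exact: le_lt_trans (level_le jk) lt.
Qed.

Lemma passage_levels : exists rho : R, [/\ 0 <= rho,
  passage s (level k) @[k --> \oo] --> rho,
  (exists K, forall k, (K <= k)%N -> passage s (level k) = rho) \/
  (forall k, passage s (level k) < rho) &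
  (u <= s rho -> rho = hitting) /\
  (s (passage s (level k)) @[k --> \oo] --> s rho -> u <= s rho)].
Proof.
have bnd : has_ubound (range sigma).
  by exists hitting => _ [k _ <-]; exact: sigma_le_hitting.
have cv := nondecreasing_cvgn sigma_nd bnd.
set rho := sup (range sigma) in cv.
have sr k : sigma k <= rho.
  by apply: ub_le_sup => //; exists k.
have rho0 : 0 <= rho by apply: le_trans (sr 0%N); apply: passage_ge0; exact: level_reached.
exists rho; split => //.
- have [H|/existsNP[K HK]] := pselect (forall k, sigma k < rho); [by right|left].
  exists K => k Kk; apply/eqP; rewrite eq_le (sr k)/=.
  apply: (@le_trans _ _ (sigma K)); last exact: sigma_nd.
  by rewrite leNgt; apply/negP.
- split=> [ur|srho].
    apply/eqP; rewrite eq_le hitting_le// andbT.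
    by apply: ge_sup => [|_ [k _ <-]]; [exists (sigma 0%N), 0%N|exact: sigma_le_hitting].
  have lvl : level k @[k --> \oo] --> u.
    rewrite -[X in _ --> X]subr0; apply: cvgB; first exact: cvg_cst.
    exact: cvg_harmonic.
  apply: (ler_cvg_to lvl srho).
  by apply: nearW => k; apply: le_passage => //; exact: level_reached.
Qed.

End levels.

Section quasi_left_continuity.
Context {dp : measure_display} {T : measurableType dp} {R : realType}.
Variables (P : probability T R) (S Z : R -> T -> R).
Hypothesis L : planar_levy P S Z.

Lemma grid_value_cvg (F : R -> T -> R) (v : R) (w : T) :
  (exists t, 0 <= t /\ v < S t w) -> near_right (F ^~ w) (passage (S ^~ w) v) ->
  grid_value S F v j w @[j --> \oo] --> (F (passage (S ^~ w) v) w)%:E.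
Proof.
move=> ex Fr; have cs := planar_cadlag1 L w.
have key (e : R) : 0 < e -> \forall j \near \oo, exists2 x : R,
    grid_value S F v j w = x%:E & `|F (passage (S ^~ w) v) w - x| < e.
  move=> e0; have [d d0 H] := Fr e e0.
  apply: filterS (grid_passage cs ex d0) => j [k [vk ltk lek kd]].
  exists (F (k%:R * 2 ^- j) w); last by rewrite distrC; exact: H.
  by apply: grid_value_crosses; split.
apply/fine_cvgP; split.
  by apply: filterS (key 1 ltr01) => j [x -> _].
by apply/cvgrPdist_lt => e e0; apply: filterS (key e e0) => j [x /= -> H].
Qed.

Section component.
Variable pr : R * R -> R.
Hypothesis pr_measurable : measurable_fun setT pr.
Let Y t w := pr (planar S Z t w).
Hypothesis Y_cadlag : forall w, cadlag (Y ^~ w).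
Hypothesis Y_start : forall w, Y 0 w = 0.
Hypothesis Y_step : forall s t w, pr (planar_step S Z s t w) = Y t w - Y s w.

Let shift (i : nat) (t : R) (w : T) : R := capped (Y (t + i.+1%:R^-1) w - Y t w).

(* Capped jump of [Y] at the limit of the first passages above levels increasing
   to [u], as a limit over meshes, levels and time lags; its mean vanishes. *)
Definition jump_mean (u : R) (w : T) : \bar R :=
  limn_einf (fun i => limn_einf (fun k => limn_einf (fun j =>
    grid_value S (fun t w => capped (pr (planar S Z (t + i.+1%:R^-1) w)
      - pr (planar S Z t w))) (level u k) j w))).

Let measurable_capped : measurable_fun setT (capped : R -> R).
Proof. by apply: measurable_minr => //; exact: normr_measurable. Qed.

Let mY t : 0 <= t -> measurable_fun setT (Y t).
Proof. by move=> t0; exact: (measurableT_comp pr_measurable (measurable_planar L t0)). Qed.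

Lemma bounded_mean_jump u : bounded_mean P (jump_mean u) 0%E.
Proof.
have i0 i : 0 <= i.+1%:R^-1 :> R by rewrite invr_ge0.
have H1 i : bounded_mean P (fun w => limn_einf (fun k => limn_einf (fun j =>
    grid_value S (shift i) (level u k) j w)))
    (\int[P]_w (capped (Y i.+1%:R^-1 w))%:E)%E.
  apply: bounded_mean_limn_einf => k; apply: bounded_mean_limn_einf => j.
  apply: (bounded_mean_grid_value L).
  - by move=> t w; exact: capped_ge0.
  - move=> t t0; apply: (measurableT_comp measurable_capped).
    by apply: measurable_funB; apply: mY => //; rewrite addr_ge0.
  - move=> N; have := @crossing_increment_le _ _ _ P S Z L (capped \o pr) _ (level u k) j N (i0 i)
      (fun x => capped_ge0 _) (measurableT_comp measurable_capped pr_measurable).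
    by under eq_bigr do under eq_integral do rewrite /= Y_step.
have mJ i := (let: And3 m _ _ := H1 i in m).
have J0 i w := (let: And3 _ p _ := H1 i in p w).
split; first exact: measurable_limn_einf.
  by move=> w; apply: limn_einf_ge0 => i; exact: J0.
apply: le_trans (fatou _ _ _ _) _ => //; first by move=> i w _; exact: J0.
have beta0 : (\int[P]_w (capped (Y i.+1%:R^-1 w))%:E)%E @[i --> \oo] --> 0%E.
  have -> : (0 = \int[P]_w (EFin \o cst 0%R) w)%E by rewrite integral0.
  apply: (@dominated_cvg _ _ _ P _ measurableT
    (fun i => EFin \o (fun w => capped (Y i.+1%:R^-1 w))) _ (EFin \o cst 1%R)) => //.
  - by move=> i; apply/measurable_EFinP; exact: (measurableT_comp measurable_capped (mY (i0 i))).
  - move=> w _; apply: cvg_EFin; first exact: nearW.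
    have -> : 0%R = capped (Y 0 w) :> R by rewrite Y_start /capped normr0 min_l.
    apply: (nonexpansive_cvg nonexpansive_capped).
    apply: (near_right_seq (y := Y ^~ w)) => //.
      exact: cadlag_near_right (Y_cadlag w) (lexx 0).
    exact: cvg_harmonic.
  - exact: finite_measure_integrable_cst.
  - by move=> i w _; rewrite lee_fin capped_le1.
have : (\int[P]_w (limn_einf (fun k => limn_einf (fun j =>
    grid_value S (shift i) (level u k) j w))))%E @[i --> \oo] --> 0%E.
  apply: (squeeze_cvge _ (cvg_cst 0%E) beta0).
  apply: nearW => i; rewrite integral_ge0//=; first by case: (H1 i).
move=> /cvg_limn_einf_sup[H _]; rewrite le_eqVlt; apply/orP; left; apply/eqP.
exact: H.
Qed.

Lemma no_jump u w (rho : R) : (exists t, 0 <= t /\ u <= S t w) -> jump_mean u w = 0%E ->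
  0 <= rho -> passage (S ^~ w) (level u k) @[k --> \oo] --> rho ->
  (exists K, forall k, (K <= k)%N -> passage (S ^~ w) (level u k) = rho) \/
  (forall k, passage (S ^~ w) (level u k) < rho) ->
  Y (passage (S ^~ w) (level u k)) w @[k --> \oo] --> Y rho w.
Proof.
move=> hit J0 rho0 cv [[K HK]|lt].
  by apply: cvg_near_cst; exists K => // k /= Kk; rewrite HK.
have reach k := level_reached hit k.
have sg0 k : 0 <= passage (S ^~ w) (level u k) by apply: passage_ge0; exact: reach.
have rho_gt0 : 0 < rho by exact: le_lt_trans (sg0 0%N) (lt 0%N).
have [l Hl] := cadlag_near_left (Y_cadlag w) rho_gt0.
pose dl i : R := i.+1%:R^-1.
have dl0 i : 0 < dl i by rewrite invr_gt0 ltr0n.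
have /choice[l_ Hl_] : forall i, exists l', near_left (Y ^~ w) (rho + dl i) l'.
  by move=> i; apply: cadlag_near_left (Y_cadlag w) _; rewrite addr_gt0.
have Yl : Y (passage (S ^~ w) (level u k)) w @[k --> \oo] --> l.
  exact: (near_left_seq Hl lt cv).
have Yl_ i : Y (passage (S ^~ w) (level u k) + dl i) w @[k --> \oo] --> l_ i.
  apply: (near_left_seq (Hl_ i)) => [k|]; first by rewrite ltrD2r.
  by apply: cvgD => //; exact: cvg_cst.
have ll : l_ i @[i --> \oo] --> Y rho w.
  apply: (@near_left_right _ (Y ^~ w) rho (fun i => rho + dl i)) => //.
  - exact: cadlag_near_right (Y_cadlag w) rho0.
  - by move=> i; rewrite ltrDl.
  - rewrite -[X in _ --> X]addr0; apply: cvgD; first exact: cvg_cst.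
    exact: cvg_harmonic.
have E1 i k : limn_einf (fun j => grid_value S (shift i) (level u k) j w) =
    (shift i (passage (S ^~ w) (level u k)) w)%:E.
  apply: (cvg_limn_einf_sup (grid_value_cvg (reach k) _)).1.
  apply: (nonexpansive_near_right nonexpansive_capped).
  apply: (near_right_increment (y := Y ^~ w)); apply: cadlag_near_right (Y_cadlag w) _ => //.
  by rewrite addr_ge0// (ltW (dl0 i)).
have E2 i : limn_einf (fun k => limn_einf (fun j => grid_value S (shift i) (level u k) j w)) =
    (capped (l_ i - l))%:E.
  under [X in limn_einf X]eq_fun do rewrite E1.
  apply: (cvg_limn_einf_sup _).1; apply: cvg_EFin; first exact: nearW.
  apply: (nonexpansive_cvg nonexpansive_capped); exact: (cvgB (Yl_ i) Yl).
have E3 : jump_mean u w = (capped (Y rho w - l))%:E.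
  rewrite /jump_mean; under [X in limn_einf X]eq_fun do rewrite E2.
  apply: (cvg_limn_einf_sup _).1; apply: cvg_EFin; first exact: nearW.
  apply: (nonexpansive_cvg nonexpansive_capped); apply: (cvgB ll); exact: cvg_cst.
move: J0; rewrite E3 => -[/capped_eq0/eqP]; rewrite subr_eq0 => /eqP ->.
exact: Yl.
Qed.

End component.

End quasi_left_continuity.

Section value_at_hitting.
Context {dp : measure_display} {T : measurableType dp} {R : realType}.
Variables (P : probability T R) (S Z : R -> T -> R).
Hypothesis L : planar_levy P S Z.

Lemma bounded_mean_top (V J1 J2 : T -> \bar R) (C : \bar R) :
  bounded_mean P V C -> bounded_mean P J1 0%E -> bounded_mean P J2 0%E ->
  bounded_mean P (fun w => V w + +oo * (J1 w + J2 w))%E C.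
Proof.
move=> [mV V0 VC] [mJ1 J10 J1C] [mJ2 J20 J2C].
have mJ : measurable_fun setT (fun w => J1 w + J2 w)%E by exact: emeasurable_funD.
have J0 w : (0 <= J1 w + J2 w)%E by rewrite adde_ge0.
have mooJ : measurable_fun setT (fun w => +oo * (J1 w + J2 w))%E.
  by apply: emeasurable_funM => //; exact: measurable_cst.
have IJ : (\int[P]_w (J1 w + J2 w) = 0)%E.
  apply/eqP; rewrite eq_le; apply/andP; split; last by apply: integral_ge0.
  by rewrite ge0_integralD//; apply: le_trans (leeD J1C J2C) _; rewrite adde0.
have ooJ0 w : (0 <= +oo * (J1 w + J2 w))%E by rewrite mule_ge0.
split; first exact: emeasurable_funD.
  by move=> w; rewrite adde_ge0.
by rewrite ge0_integralD// ge0_integralZl// IJ mule0 adde0.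
Qed.

Lemma bounded_mean_ge0 (f : T -> \bar R) C w : bounded_mean P f C -> (0 <= f w)%E.
Proof. by case. Qed.

Lemma ruin_event_reached u w : ruin_event S u w -> exists t, 0 <= t /\ u <= S t w.
Proof.
rewrite /ruin_event /ruin_time /= => H; apply: contrapT => nex; move: H.
suff -> : [set t%:E | t in [set t : R | 0 <= t /\ u <= S t w]] = set0.
  by rewrite ereal_inf0 ltxx.
by rewrite -subset0 => _ [t tu <-]; apply: nex; exists t.
Qed.

Lemma ruin_time_hitting u w : ruin_event S u w ->
  fine (ruin_time S u w) = hitting (S ^~ w) u.
Proof.
move=> /ruin_event_reached ex; rewrite /ruin_time ereal_inf_EFin//.
by exists 0 => t [].
Qed.

Lemma reached_ruin_event u w t : 0 <= t -> u <= S t w -> ruin_event S u w.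
Proof.
move=> t0 ut; rewrite /ruin_event /=; apply: (@le_lt_trans _ _ t%:E); last exact: ltry.
by apply: ereal_inf_lbound; exists t.
Qed.

Section component.
Variable pr : R * R -> R.
Hypothesis pr_measurable : measurable_fun setT pr.
Let Y t w := pr (planar S Z t w).
Hypothesis Y_cadlag : forall w, cadlag (Y ^~ w).
Hypothesis Y_start : forall w, Y 0 w = 0.
Hypothesis Y_step : forall s t w, pr (planar_step S Z s t w) = Y t w - Y s w.
Variable f : R -> R.
Hypothesis f_nonexpansive : nonexpansive f.
Hypothesis f_measurable : measurable_fun setT f.
Hypothesis f_ge0 : forall x, 0 <= f x.

Lemma hitting_value u w : (exists t, 0 <= t /\ u <= S t w) ->
  jump_mean S Z fst u w = 0%E -> jump_mean S Z pr u w = 0%E ->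
  limn_einf (fun k => limn_einf (fun j => grid_value S (fun t w => f (Y t w)) (level u k) j w))
  = (f (Y (hitting (S ^~ w) u) w))%:E.
Proof.
move=> ex J1 J2.
have [rho [rho0 cv dich [rhoE urho]]] := passage_levels (planar_cadlag1 L w) ex.
have Scv : S (passage (S ^~ w) (level u k)) w @[k --> \oo] --> S rho w.
  exact: (@no_jump _ _ _ P S Z L fst (planar_cadlag1 L) u w rho ex J1 rho0 cv dich).
have -> : hitting (S ^~ w) u = rho by rewrite rhoE//; exact: urho.
have Ycv : Y (passage (S ^~ w) (level u k)) w @[k --> \oo] --> Y rho w.
  exact: (@no_jump _ _ _ P S Z L pr Y_cadlag u w rho ex J2 rho0 cv dich).
have E1 k : limn_einf (fun j => grid_value S (fun t w => f (Y t w)) (level u k) j w) =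
    (f (Y (passage (S ^~ w) (level u k)) w))%:E.
  apply: (cvg_limn_einf_sup (grid_value_cvg L (level_reached ex k) _)).1.
  apply: (nonexpansive_near_right f_nonexpansive (y := Y ^~ w)).
  apply: cadlag_near_right (Y_cadlag w) _; apply: passage_ge0; exact: level_reached.
under [X in limn_einf X]eq_fun do rewrite E1.
apply: (cvg_limn_einf_sup _).1; apply: cvg_EFin; first exact: nearW.
exact: (nonexpansive_cvg f_nonexpansive Ycv).
Qed.

Lemma hitting_value_dominated u (C : \bar R) :
  (forall (v : R) j N, (u - 1 <= v)%R -> (v < u)%R ->
    \sum_(k < N) \int[P]_(w in crosses S (2 ^- j) v k) (f (Y (k%:R * 2 ^- j)%R w))%:E <= C)%E ->
  exists2 G, bounded_mean P G C &
    forall w, ruin_event S u w -> ((f (Y (fine (ruin_time S u w)) w))%:E <= G w)%E.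
Proof.
move=> HC.
pose V w := limn_einf (fun k => limn_einf (fun j =>
  grid_value S (fun t w => f (Y t w)) (level u k) j w)).
have VC : bounded_mean P V C.
  apply: bounded_mean_limn_einf => k; apply: bounded_mean_limn_einf => j.
  apply: (bounded_mean_grid_value L) => // [t t0|N].
    apply: (measurableT_comp f_measurable).
    exact: (measurableT_comp pr_measurable (measurable_planar L t0)).
  by apply: HC; [exact: level_ge|exact: level_lt].
have J1 : bounded_mean P (jump_mean S Z fst u) 0%E.
  exact: (@bounded_mean_jump _ _ _ P S Z L fst measurable_fst
    (planar_cadlag1 L) (planar_start1 L) (fun s t w => erefl) u).
have J2 : bounded_mean P (jump_mean S Z pr u) 0%E.
  exact: (@bounded_mean_jump _ _ _ P S Z L pr pr_measurable Y_cadlag Y_start Y_step u).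
(* The second term is almost surely [0]; it discards the paths with a jump. *)
exists (fun w => V w + +oo * (jump_mean S Z fst u w + jump_mean S Z pr u w))%E.
  exact: (bounded_mean_top VC J1 J2).
have V0 : forall w, (0 <= V w)%E by move=> w; exact: (bounded_mean_ge0 w VC).
have J10 : forall w, (0 <= jump_mean S Z fst u w)%E by move=> w; exact: (bounded_mean_ge0 w J1).
have J20 : forall w, (0 <= jump_mean S Z pr u w)%E by move=> w; exact: (bounded_mean_ge0 w J2).
move=> w Aw; rewrite ruin_time_hitting//.
have [Jw|Jw] := eqVneq (jump_mean S Z fst u w + jump_mean S Z pr u w)%E 0%E.
  have /eqP := Jw; rewrite (padde_eq0 (J10 w) (J20 w)) => /andP[/eqP j1 /eqP j2].
  rewrite Jw mule0 adde0 /V (hitting_value (ruin_event_reached Aw) j1 j2).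
  exact: lexx.
rewrite gt0_mulye ?lt0e ?Jw ?adde_ge0// addey ?leey//.
by rewrite -ltNye (lt_le_trans _ (V0 w)).
Qed.

End component.

End value_at_hitting.

(** * The contribution ratio *)

Section ruin_value.
Context {dp : measure_display} {T : measurableType dp} {R : realType}.
Variables (P : probability T R) (S Z : R -> T -> R) (th : R).
Hypothesis L : planar_levy P S Z.
Hypothesis th0 : 0 < th.
Hypothesis th_mean : forall t, 0 <= t -> (\int[P]_w (expR (th * S t w))%:E = 1)%E.
Local Notation weight t := (fun w => expR (th * S t w)).
Hypotheses (iS : P.-integrable setT (EFin \o (S 1 \* weight 1)))
  (mS_gt0 : 0 < \int[P]_w (S 1 w * expR (th * S 1 w)))
  (Zcentered : tilted_centered P S Z th 1).
Hypothesis ruin_possible : forall u, 0 < u -> ('E_P[\1_(ruin_event S u)] > 0)%E.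

Let A u := ruin_event S u.
Let tau u w := fine (ruin_time S u w).
Let p u := ('E_P[\1_(A u)])%E.
Let D u w := S (tau u w) w * \1_(A u) w.

Let D_ge u w : 0 <= u -> u * \1_(A u) w <= D u w.
Proof.
move=> u0; rewrite /D indicE.
have [/set_mem Aw|_] := boolP (w \in A u); last by rewrite !mulr0.
rewrite !mulr1 /tau (ruin_time_hitting Aw).
exact: le_hitting (planar_cadlag1 L w) (ruin_event_reached Aw).
Qed.

Let D_ge0 u w : 0 <= u -> 0 <= D u w.
Proof. by move=> u0; apply: le_trans (D_ge w u0); rewrite mulr_ge0. Qed.

Let pE u : p u = (\int[P]_w (\1_(A u) w)%:E)%E. Proof. by rewrite /p unlock. Qed.

Let p_fin u : 0 < u -> exists2 q : R, p u = q%:E & 0 < q.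
Proof.
move=> u0; have p0 := ruin_possible u0.
have p1 : (p u <= 1)%E.
  have <- : (\int[P]_(w in setT) (1 : \bar R) = 1)%E.
    rewrite integral_cst//.
    by rewrite mul1e; exact: probability_setT.
  rewrite pE; apply: ge0_le_integral_lower => w _.
    by rewrite lee_fin.
  by rewrite lee_fin indicE lern1 leq_b1.
have pf : p u \is a fin_num by rewrite ge0_fin_numE ?(ltW p0)// (le_lt_trans p1)// ltry.
exists (fine (p u)); first by rewrite fineK.
by rewrite -lte_fin fineK.
Qed.

Let p_ge : exists2 c : R, 0 < c & forall u, 0 <= u -> ((c * expR (- (th * u)))%:E <= p u)%E.
Proof.
have [c c0 Hc] := crossing_probability_ge L th0 th_mean iS mS_gt0.
exists c => // u u0; have [N HN] := Hc u u0; apply: le_trans HN _.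
have mc k : measurable (crosses S 1 u k).
  by apply: (grid_past_measurable L ler01 (k := k)); exact: (grid_past_crosses L).
rewrite -(measure_bigsetU P (F := crosses S 1 u))//; last exact: crosses_trivIset.
have mU : measurable (\big[setU/set0]_(k < N) crosses S 1 u k).
  by apply: bigsetU_measurable => k _.
apply: (@le_trans _ _ (\int[P]_w (\1_(\big[setU/set0]_(k < N) crosses S 1 u k) w)%:E)%E).
  by rewrite integral_indic// setIT.
rewrite pE; apply: ge0_le_integral_lower => w _; rewrite lee_fin// !indicE ler_nat.
case: (boolP (w \in \big[_/_]_(_ < N) _)) => //.
rewrite inE -bigcup_mkord => -[k /= _ [_ /= uk]].
by rewrite mem_set//; apply: (reached_ruin_event (t := k%:R * 1)) (ltW uk); rewrite mulr_ge0.
Qed.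

Let D_finite u : 1 <= u -> (\int[P]_w (D u w)%:E < +oo)%E.
Proof.
move=> u1; have u0 : 0 <= u by exact: le_trans u1.
have u10 : 0 <= u - 1 by rewrite subr_ge0.
have [G [mG G0 GC] HG] := @hitting_value_dominated _ _ _ P S Z L fst measurable_fst
  (planar_cadlag1 L) (planar_start1 L) (fun s t w => erefl) (fun x => Num.max x 0)
  nonexpansive_pos measurable_pos pos_ge0 u th^-1%:E
  (fun v j N uv _ => crossing_level_le L th0 th_mean j N (le_trans u10 uv)).
apply: le_lt_trans (ltry th^-1); apply: le_trans GC.
apply: ge0_le_integral_lower => w _; first by rewrite lee_fin D_ge0.
rewrite /D indicE; have [/set_mem Aw|_] := boolP (w \in A u); last by rewrite mulr0.
by rewrite mulr1; apply: le_trans (HG w Aw); rewrite lee_fin le_max lexx.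
Qed.

Variables (X : R -> T -> R) (c : R).
Hypothesis XE : forall t w, X t w = c * S t w + Z t w.

Let ratio_estimate (c1 C e u q F E : R) : 0 < c1 -> 0 <= C -> 0 < e -> 1 <= u ->
  c1 * expR (- (th * u)) <= q -> u * q <= E ->
  `|F - c * E| <= expR (- (th * (u - 1))) * (C + e * u) *+ 2 ->
  `|c - F / E| <= (2 * expR th * C / c1) / u + 2 * expR th * e / c1.
Proof.
move=> c10 C0 e0 u1 cq uq; have u0 : 0 < u by exact: lt_le_trans u1.
have -> : - (th * (u - 1)) = - (th * u) + th by rewrite mulrBr mulr1 opprB addrC.
rewrite expRD; have := expR_gt0 (- (th * u)); have := expR_gt0 th.
move: (expR th) (expR (- (th * u))) cq => b a cq b0 a0 FE.
have ca : 0 < c1 * a by rewrite mulr_gt0.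
have E0 : 0 < E by apply: lt_le_trans uq; rewrite mulr_gt0// (lt_le_trans ca).
have -> : c - F / E = - ((F - c * E) / E) by field; rewrite gt_eqF.
rewrite normrN normrM (gtr0_norm (_ : 0 < E^-1)) ?invr_gt0//.
have -> : 2 * b * C / c1 / u + 2 * b * e / c1 = (a * b * (C + e * u) *+ 2) / (u * (c1 * a)).
  by rewrite -mulr_natl; field; rewrite !gt_eqF.
apply: ler_pM => //; first by rewrite invr_ge0 ltW.
rewrite lef_pV2 ?posrE ?mulr_gt0//; apply: le_trans uq.
by rewrite ler_wpM2l// ltW.
Qed.

Let ratio_near (e : R) : 0 < e -> exists2 C, 0 <= C & forall u, 1 <= u ->
  exists2 r : R, ('E_P[(fun w => X (tau u w) w * \1_(A u) w)%R] / p u /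
    ('E_P[D u] / p u))%E = r%:E & `|c - r| <= C / u + e.
Proof.
move=> e0; have [c1 c10 Hp] := p_ge.
have b0 : 0 < 2 * expR th by rewrite mulr_gt0// expR_gt0.
pose e1 := e * c1 / (2 * expR th).
have e10 : 0 < e1 by rewrite divr_gt0// mulr_gt0.
have [C C0 HC] := crossing_norm_le L th0 th_mean iS mS_gt0 Zcentered e10.
exists (2 * expR th * C / c1) => [|u u1]; first by rewrite divr_ge0 ?mulr_ge0// ltW.
have u0 : 0 < u by exact: lt_le_trans u1.
have [q pq q0] := p_fin u0.
pose g := expR (- (th * (u - 1))) * (C + e1 * u).
have crossing_le (v : R) j N : u - 1 <= v -> v < u ->
    (\sum_(k < N) \int[P]_(w in crosses S (2 ^- j) v k) `|Z (k%:R * 2 ^- j)%R w|%:E <= g%:E)%E.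
  move=> uv vu; have v0 : 0 <= v by apply: le_trans uv; rewrite subr_ge0.
  apply: le_trans (HC j v N v0) _; rewrite lee_fin; apply: ler_pM.
  - exact: expR_ge0.
  - by rewrite addr_ge0// mulr_ge0// ltW.
  - by rewrite ler_expR lerN2 ler_wpM2l// ltW.
  - by rewrite lerD2l ler_wpM2l// ltW.
have [G [mG G0 GC] HG] := @hitting_value_dominated _ _ _ P S Z L snd measurable_snd
  (planar_cadlag2 L) (planar_start2 L) (fun s t w => erefl) (fun x => `|x|)
  (@nonexpansive_norm R) (@normr_measurable R setT) (@normr_ge0 _ _) u g%:E crossing_le.
have fDG w : (`|X (tau u w) w * \1_(A u) w - c * D u w|%:E <= G w)%E.
  have -> : X (tau u w) w * \1_(A u) w - c * D u w = Z (tau u w) w * \1_(A u) w.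
    by rewrite XE /D; ring.
  rewrite indicE; have [/set_mem Aw|_] := boolP (w \in A u).
    by rewrite mulr1; exact: HG.
  by rewrite mulr0 normr0.
have Doo := D_finite u1.
have [Ffin FD] := integral_perturb_lower (fun w => D_ge0 w (ltW u0)) mG fDG Doo GC.
have Dfin : (\int[P]_w (D u w)%:E)%E \is a fin_num.
  by rewrite ge0_fin_numE// integral_ge0// => w _; rewrite lee_fin D_ge0// ltW.
have pD : u * q <= fine (\int[P]_w (D u w)%:E)%E.
  rewrite -lee_fin fineK// EFinM -pq pE -ge0_integralZl_lower ?(ltW u0)//.
  apply: ge0_le_integral_lower => w _; rewrite -EFinM lee_fin; first by rewrite mulr_ge0// ltW.
  by apply: D_ge; exact: ltW.
have D0 : 0 < fine (\int[P]_w (D u w)%:E)%E by apply: lt_le_trans pD; rewrite mulr_gt0.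
set F := (fun w => X (tau u w) w * \1_(A u) w) in Ffin FD *.
have cq : c1 * expR (- (th * u)) <= q by rewrite -lee_fin -pq Hp// ltW.
exists (fine (\int[P]_w (F w)%:E)%E / fine (\int[P]_w (D u w)%:E)%E).
  rewrite pq !unlock -(fineK Ffin) -(fineK Dfin) !inver gt_eqF// -!EFinM inver.
  rewrite gt_eqF ?divr_gt0// -EFinM; congr EFin; field.
  by rewrite !gt_eqF.
have -> : e = 2 * expR th * e1 / c1 by rewrite /e1; field; rewrite !gt_eqF// expR_gt0.
exact: (ratio_estimate c10 C0 e10 u1 cq pD FD).
Qed.

Lemma ruin_value_ratio :
  (cond_expectation P (A u) (fun w => X (tau u w) w) /
   cond_expectation P (A u) (fun w => S (tau u w) w))%E @[u --> +oo] --> c%:E.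
Proof.
have e_gt0 (e : R) : 0 < e -> exists2 M : R, 0 < M & forall u, M < u ->
  exists2 r : R, (cond_expectation P (A u) (fun w => X (tau u w) w) /
   cond_expectation P (A u) (fun w => S (tau u w) w))%E = r%:E & `|c - r| < e.
  move=> e0; have e2 : 0 < e / 2 by rewrite divr_gt0.
  have [C C0 H] := ratio_near e2.
  exists (Num.max 1 (2 * C / e)) => [|u]; first by rewrite lt_max ltr01.
  rewrite gt_max => /andP[u1 uC]; have [r rE cr] := H u (ltW u1).
  exists r; first exact: rE.
  apply: le_lt_trans cr _; rewrite [ltRHS]splitr ltrD2r.
  have u0 : 0 < u by exact: lt_trans u1.
  rewrite ltr_pdivrMr//; move: uC; rewrite ltr_pdivrMr// -[X in _ -> _ < X]mulrAC ltr_pdivlMr//.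
  by rewrite mulrC (mulrC u).
apply/fine_cvgP; split.
  have [M M0 H] := e_gt0 1 ltr01.
  by exists M; split; [exact: num_real|] => u /H[r -> _].
apply/cvgrPdist_lt => e /e_gt0[M M0 H].
by exists M; split; [exact: num_real|] => u /H[r /= -> ].
Qed.

End ruin_value.

Section cadlag_functions.
Context {R : realType}.
Implicit Types f g : R -> R.

Lemma cadlag_cst (a : R) : cadlag (fun=> a).
Proof. by split=> t _; [exact: cvg_cst|exact: is_cvg_cst]. Qed.

Lemma cadlagD f g : cadlag f -> cadlag g -> cadlag (fun t => f t + g t).
Proof.
move=> [fr fl] [gr gl]; split=> t t0; first by apply: cvgD; [exact: fr|exact: gr].
by apply: is_cvgD; [exact: fl|exact: gl].
Qed.

Lemma cadlagZ (a : R) f : cadlag f -> cadlag (fun t => a * f t).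
Proof.
move=> [fr fl]; split=> t t0; first by apply: cvgMr; exact: fr.
by apply: is_cvgMr; exact: fl.
Qed.

Lemma cadlag_sum (I : Type) (s : seq I) (f : I -> R -> R) :
  (forall i, cadlag (f i)) -> cadlag (fun t => \sum_(i <- s) f i t).
Proof.
move=> cf; elim: s => [|i s IHs].
  by under [X in cadlag X]eq_fun do rewrite big_nil; exact: cadlag_cst.
by under [X in cadlag X]eq_fun do rewrite big_cons; exact: cadlagD.
Qed.

End cadlag_functions.

Section levy_planar.
Context {dp : measure_display} {T : measurableType dp} {R : realType}.
Variables (P : probability T R) (d : nat) (X : R -> T -> d.-tuple R).
Hypothesis XL : levy_process P X.
Variables (i : 'I_d) (c : R).

Let Z (t : R) (w : T) : R := component X i t w - c * aggregate X t w.

Let proj (x : d.-tuple R) : R * R :=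
  (\sum_(j < d) tnth x j, tnth x i - c * \sum_(j < d) tnth x j).

Let measurable_proj : measurable_fun setT proj.
Proof.
have ms : measurable_fun setT (fun x : d.-tuple R => \sum_(j < d) tnth x j).
  by apply: measurable_sum => j; exact: measurable_tnth.
apply/measurable_fun_pair => //; apply: measurable_funB; first exact: measurable_tnth.
exact: measurable_funM.
Qed.

Let step_proj s t : planar_step (aggregate X) Z s t = proj \o increment X s t.
Proof.
apply/funext => w; rewrite /planar_step /proj /= /Z /aggregate /component.
have -> : \sum_(j < d) tnth (increment X s t w) j =
    \sum_(j < d) tnth (X t w) j - \sum_(j < d) tnth (X s w) j.
  by rewrite -sumrB; apply: eq_bigr => j _; rewrite tnth_mktuple.
by rewrite tnth_mktuple; congr pair; ring.
Qed.

Lemma measurable_component j t : 0 <= t -> measurable_fun setT (component X j t).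
Proof.
move=> t0; exact: (measurableT_comp (measurable_tnth j) (levy_measurable XL t0)).
Qed.

Lemma measurable_aggregate t : 0 <= t -> measurable_fun setT (aggregate X t).
Proof. by move=> t0; apply: measurable_sum => j; exact: measurable_component. Qed.

Lemma levy_planar : planar_levy P (aggregate X) Z.
Proof.
have ca w : cadlag (aggregate X ^~ w).
  by apply: cadlag_sum => j; exact: levy_cadlag XL w j.
split => //.
- exact: measurable_aggregate.
- move=> t t0; apply: measurable_funB; first exact: measurable_component.
  by apply: measurable_funM => //; exact: measurable_aggregate.
- by move=> w; apply: big1 => j _; exact: levy_start0 XL w j.
- move=> w; rewrite /Z /component (levy_start0 XL) /aggregate big1 ?mulr0 ?subr0//.
  by move=> j _; exact: levy_start0 XL w j.
- move=> n t B t0 tle mB; under eq_bigcapr do rewrite step_proj comp_preimage.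
  rewrite (levy_independent XL)//; last first.
    by move=> k; rewrite -[X in measurable X]setTI; exact: measurable_proj.
  by apply: eq_bigr => k _; rewrite step_proj comp_preimage.
- move=> s t B s0 t0 mB; rewrite !step_proj !comp_preimage.
  apply: (levy_stationary XL) => //.
  by rewrite -[X in measurable X]setTI; exact: measurable_proj.
- move=> w; rewrite /Z; under [X in cadlag X]eq_fun do rewrite -mulNr.
  by apply: cadlagD; [exact: levy_cadlag XL w i|exact: cadlagZ].
Qed.

End levy_planar.

Section tilted_mean_positive.
Context {dp : measure_display} {T : measurableType dp} {R : realType}.
Variable P : probability T R.

Lemma integrable_integral_fin_num (f : T -> R) : measurable_fun setT f ->
  (\int[P]_w (f w)%:E)%E \is a fin_num -> P.-integrable setT (EFin \o f).
Proof.
move=> mf ff; apply/integrableP; split; first exact/measurable_EFinP.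
by rewrite integral_fin_num_abs.
Qed.

Lemma tilted_mean_gt0 (f : T -> R) (th : R) : 0 < th -> measurable_fun setT f ->
  (\int[P]_w (expR (th * f w))%:E = 1)%E ->
  P.-integrable setT (EFin \o (f \* (fun w => expR (th * f w)))) ->
  ~ {ae P, forall w, f w = 0} ->
  0 < \int[P]_w (f w * expR (th * f w)).
Proof.
move=> th0 mf mean1 iff nae.
pose e w := expR (th * f w).
have me : measurable_fun setT e.
  apply: (measurableT_comp (@measurable_expR R)); exact: measurable_funM.
have ie : P.-integrable setT (EFin \o e).
  by apply: integrable_integral_fin_num => //; rewrite mean1.
pose k w := th * (f w * e w) - (e w - 1).
have kpos w : th * f w != 0 -> 0 < k w.
  move=> fw; have := @expR_gt1Dx _ (- (th * f w)); rewrite oppr_eq0 expRN => /(_ fw).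
  rewrite -/(e w) -(ltr_pM2r (expR_gt0 (th * f w))) mulVf ?gt_eqF ?expR_gt0// -/(e w) /k; lra.
have k0 w : 0 <= k w.
  have [fw|/kpos/ltW//] := eqVneq (th * f w) 0.
  by rewrite /k mulrA fw mul0r /e fw expR0 subrr subr0.
have i1 : P.-integrable setT (EFin \o cst (1 : R)) by exact: finite_measure_integrable_cst.
have ithf : P.-integrable setT (EFin \o (fun w => th * (f w * e w))).
  by apply: (@integrableZl _ _ _ P _ measurableT th (EFin \o (f \* e))).
have ie1 : P.-integrable setT (EFin \o (fun w => e w - 1)).
  exact: (@integrableB _ _ _ P _ measurableT (EFin \o e) (EFin \o cst 1)).
have ik : P.-integrable setT (EFin \o k).
  exact: (@integrableB _ _ _ P _ measurableT (EFin \o (fun w => th * (f w * e w))) (EFin \o (fun w => e w - 1))).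
have kE : \int[P]_w k w = th * \int[P]_w (f w * e w).
  rewrite RintegralB// RintegralZl// RintegralB// /Rintegral mean1.
  have -> : (\int[P]_(w in setT) (1 : \bar R) = 1)%E.
    by rewrite integral_cst// mul1e; exact: probability_setT.
  by rewrite subrr subr0.
rewrite -(pmulr_rgt0 _ th0) -kE lt_neqAle Rintegral_ge0// andbT.
apply/negP => /eqP Ik0; apply: nae.
have : (\int[P]_(w in setT) `|(EFin \o k) w| = 0)%E.
  under eq_integral do rewrite /= ger0_norm//.
  by rewrite -[LHS]fineK ?(integrable_fin_num _ ik)// -[RHS]/(0%:E) Ik0.
move/(ae_eq_integral_abs P measurableT (measurable_int _ ik)).1.
apply: filterS => w kw0; have kw : k w = 0 by exact: EFin_inj (kw0 I).
have [/eqP|/kpos] := eqVneq (th * f w) 0; last by rewrite kw ltxx.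
by rewrite mulf_eq0 gt_eqF//= => /eqP.
Qed.

End tilted_mean_positive.

Lemma levy_exponent_nondegenerate {dp : measure_display} {T : measurableType dp}
    {R : realType} (P : probability T R) (Y : R -> T -> R) (kappa : R -> \bar R)
    (l : \bar R) : measurable_fun setT (Y 1) -> levy_exponent P Y kappa ->
  domain_derivative kappa 0 l -> (l < 0)%E -> ~ {ae P, forall w, Y 1 w = 0}.
Proof.
move=> mY kappaE [_ dl] l0 Y0.
have kappa0 x : kappa x = 0%E.
  apply: expeR_inj; rewrite expeR0 -[kappa x]mul1e -(kappaE x 1 ler01).
  rewrite /mmt_gen_fun unlock (@ae_eq_integral _ _ _ P setT (cst 1%E))//.
  - by rewrite integral_cst// mul1e; exact: probability_setT.
  - apply/measurable_EFinP; apply: (measurableT_comp (@measurable_expR R)).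
    exact: measurable_funM.
  - by apply: filterS Y0 => w /= -> _; rewrite mul0r expR0.
have domE : [set h | kappa (0 + h) \is a fin_num] = setT.
  by rewrite -subTset => h _ /=; rewrite kappa0.
have quotE : (fun h => ((fine (kappa (0 + h)) - fine (kappa 0)) / h)%:E) = cst 0%E.
  by apply/funext => h; rewrite !kappa0 subrr mul0r.
move: dl; rewrite domE withinET quotE => dl.
have l0E : l = 0%E.
  by apply: (@cvg_unique _ (@ereal_hausdorff R) (cst 0%E @ (0 : R)^')) => //; exact: cvg_cst.
by move: l0; rewrite l0E ltxx.
Qed.

Unset Implicit Arguments.

Theorem theorem1 (R : realType) (dp : measure_display) (T : measurableType dp)
    (P : probability T R) (d : nat) (S : R -> T -> d.-tuple R)
    (kappa : R -> \bar R) (theta_star : R)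
    (Q : probability T R) (m : 'I_d -> R)
    (d_ge2 : (2 <= d)%N)
    (S_levy : levy_process P S)
    (kappa_exponent : levy_exponent P (aggregate S) kappa)
    (kappa'0_lt0 : exists2 l : \bar R,
       domain_derivative kappa 0 l & (l < 0)%E)
    (S_not_neg_subordinator : ~ subordinator P (fun t w => - aggregate S t w))
    (theta_star_gt0 : 0 < theta_star)
    (kappa_theta_star : kappa theta_star = 0%E)
    (ruin_possible : forall u : R, 0 < u ->
       (0 < 'E_P[\1_(ruin_event (aggregate S) u)])%E)
    (Q_tilted : exponentially_tilted P Q S theta_star)
    (Q_integrable : forall i : 'I_d, ('E_Q[fun w => `|component S i 1 w|%R] < +oo)%E)
    (m_derivative : forall i : 'I_d,
       domain_derivative
         (fun x => joint_mgf P (S 1) (fun j => if j == i then x else theta_star))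
         theta_star (m i)%:E)
    (m_expectation : forall i : 'I_d,
       (m i)%:E
       = 'E_P[fun w => (component S i 1 w * expR (theta_star * aggregate S 1 w))%R]%E) :
  forall i : 'I_d,
    contribution P S i u @[u --> +oo] --> (m i / \sum_(j < d) m j)%:E.
Proof.
have mC j := measurable_component S_levy j ler01.
have mA : measurable_fun setT (aggregate S 1) := measurable_aggregate S_levy ler01.
pose e w := expR (theta_star * aggregate S 1 w).
have me : measurable_fun setT e.
  apply: (measurableT_comp (@measurable_expR R)); exact: measurable_funM.
have mean1 t : 0 <= t -> (\int[P]_w (expR (theta_star * aggregate S t w))%:E = 1)%E.
  move=> t0; have := kappa_exponent theta_star t t0.
  rewrite kappa_theta_star mule0 expeR0 /mmt_gen_fun unlock => <-.
  by apply: eq_integral => w _ /=; rewrite mulrC.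
have ICe j : (\int[P]_w (component S j 1 w * e w)%:E = (m j)%:E)%E.
  by rewrite m_expectation unlock.
have iC j : P.-integrable setT (EFin \o (component S j 1 \* e)).
  by apply: integrable_integral_fin_num; [exact: measurable_funM|rewrite ICe].
have AE : EFin \o (aggregate S 1 \* e) =
    (fun w => \sum_(j < d) (EFin \o (component S j 1 \* e)%R) w)%E.
  by apply/funext => w /=; rewrite /aggregate mulr_suml sumEFin.
have iA : P.-integrable setT (EFin \o (aggregate S 1 \* e)).
  by rewrite AE; apply: integrable_sum => // j _; exact: iC.
have IA : \int[P]_w (aggregate S 1 w * e w) = \sum_(j < d) m j.
  rewrite /Rintegral -[X in fine X]/(\int[P]_w (EFin \o (aggregate S 1 \* e)%R) w)%E AE.
  rewrite integral_sum//; under eq_bigr do rewrite ICe.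
  by rewrite sumEFin.
have [l dl l0] := kappa'0_lt0.
have nae := levy_exponent_nondegenerate mA kappa_exponent dl l0.
have m0 : 0 < \int[P]_w (aggregate S 1 w * e w).
  exact: tilted_mean_gt0 theta_star_gt0 mA (mean1 1 ler01) iA nae.
move=> i; pose c := m i / \sum_(j < d) m j.
have centered : tilted_centered P (aggregate S)
    (fun t w => component S i t w - c * aggregate S t w) theta_star 1.
  have E w : (component S i 1 w - c * aggregate S 1 w) * e w =
      component S i 1 w * e w - c * (aggregate S 1 w * e w) by ring.
  have icA : P.-integrable setT (EFin \o (fun w => c * (aggregate S 1 w * e w))).
    by apply: (@integrableZl _ _ _ P _ measurableT c (EFin \o (aggregate S 1 \* e))).
  split.
    have -> : EFin \o ((fun w => component S i 1 w - c * aggregate S 1 w) \* e) =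
        (fun w => (component S i 1 w * e w)%:E - (c * (aggregate S 1 w * e w))%:E)%E.
      by apply/funext => w /=; rewrite E.
    exact: (@integrableB _ _ _ P _ measurableT (EFin \o (component S i 1 \* e))).
  under eq_Rintegral do rewrite E.
  rewrite (RintegralB measurableT (iC i) icA) (RintegralZl c measurableT iA) IA.
  rewrite /Rintegral ICe /c divfK ?subrr//.
  by rewrite gt_eqF// -IA.
apply: (ruin_value_ratio (levy_planar S_levy i c) theta_star_gt0 mean1 iA m0 centered
  ruin_possible).
by move=> t w; rewrite addrC subrK.
Qed.
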